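(* \textsc{Path Discovery} and \textsc{Shortest Path Discovery} (in the directed weighted two-graph model) are fixed-parameter tractable when parameterized by the number $k=|S|$ of tokens.
   Context: Two-graph model. An instance is $(G,M,s,t,S,b)$ where $G$ (the problem graph) is a directed graph with integer edge weights $w_G\colon E(G)\to\mathbb Z$ and no negative-weight cycle, $M$ (the movement graph) is a directed graph on the same vertex set $V$ with nonnegative integer edge weights $w_M\colon E(M)\to\mathbb Z_{\ge 0}$, $s,t\in V$ are distinct, $S$ is a multiset of vertices (the initial token configuration; $k=|S|$ is the number of tokens), and $b\in\mathbb Z$ is the budget. A move takes a token at a vertex $x$ and an edge $(x,y)\in E(M)$ and relocates that token to $y$, at cost $w_M(x,y)$. A configuration $T$ (multiset) is reachable from $S$ within budget $b$ if there is a sequence of moves transforming $S$ into $T$ of total cost at most $b$. An $s$-$t$ path is a sequence of pairwise distinct vertices $s=v_0,\dots,v_\ell=t$ with $(v_{i-1},v_i)\in E(G)$; its weight is the sum of $w_G$ over its edges; a shortest $s$-$t$ path is one of minimum weight. \textsc{Path Discovery} asks whether some configuration $T$ reachable from $S$ within budget $b$ contains (as a set) the vertex set of some $s$-$t$ path of $G$; \textsc{Shortest Path Discovery} asks the same with a shortest $s$-$t$ path of $G$. (Unused tokens may be ignored; tokens may share a vertex.) *)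

(* Defs.v *)
From mathcomp Require Import all_boot all_order all_algebra finmap multiset.

Set Implicit Arguments.
Unset Strict Implicit.
Unset Printing Implicit Defensive.

Import Order.TTheory GRing.Theory Num.Theory.

Local Open Scope ring_scope.
Local Open Scope mset_scope.

(** * Computation

    The machine model is the random access machine with addition and
    subtraction under the logarithmic cost criterion (polynomially equivalent to
    multitape Turing machines), with structured control flow instead of jumps.
    An unbounded memory of integer cells is the only storage; every
    subexpression is charged the bit length of its value, hence every access is
    charged the length of both its address and its contents. *)

Definition bitlen (z : int) : nat := (trunc_log 2 `|z|%N).+1.

Definition memory := nat -> int.

Inductive expr :=
| Cst of int
| Get of expr
| Plus of expr & expr
| Minus of expr & expr.

(* The address denoted by an integer is its absolute value. *)
Fixpoint eval (m : memory) (e : expr) : int :=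
  match e with
  | Cst z => z
  | Get e1 => m `|eval m e1|%N
  | Plus e1 e2 => eval m e1 + eval m e2
  | Minus e1 e2 => eval m e1 - eval m e2
  end.

Fixpoint ecost (m : memory) (e : expr) : nat :=
  (bitlen (eval m e) +
   match e with
   | Cst _ => 0
   | Get e1 => ecost m e1
   | Plus e1 e2 | Minus e1 e2 => ecost m e1 + ecost m e2
   end)%N.

(* [Write a e] stores the value of [e] at address [a]; [If] and [While] test
   whether their guard is positive. *)
Inductive program :=
| Skip
| Write of expr & expr
| Seq of program & program
| If of expr & program & program
| While of expr & program.

Definition update (m : memory) (a : nat) (z : int) : memory :=
  fun i => if i == a then z else m i.

(* [exec p m c m'] : started on [m], the program [p] halts on [m'] at cost [c]. *)
Inductive exec : program -> memory -> nat -> memory -> Prop :=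
| exec_skip m : exec Skip m 1 m
| exec_write m a e :
    exec (Write a e) m (1 + ecost m a + ecost m e)
         (update m `|eval m a|%N (eval m e))
| exec_seq p q m c1 m1 c2 m2 :
    exec p m c1 m1 -> exec q m1 c2 m2 -> exec (Seq p q) m (c1 + c2) m2
| exec_if_true e p q m c m' :
    0 < eval m e -> exec p m c m' -> exec (If e p q) m (1 + ecost m e + c) m'
| exec_if_false e p q m c m' :
    eval m e <= 0 -> exec q m c m' -> exec (If e p q) m (1 + ecost m e + c) m'
| exec_while_true e p m c1 m1 c2 m2 :
    0 < eval m e -> exec p m c1 m1 -> exec (While e p) m1 c2 m2 ->
    exec (While e p) m (1 + ecost m e + c1 + c2) m2
| exec_while_false e p m :
    eval m e <= 0 -> exec (While e p) m (1 + ecost m e) m.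

(* The input occupies the first cells; all others are 0. *)
Definition load (s : seq int) : memory := fun i => nth 0 s i.

Definition bitsize (s : seq int) : nat := (\sum_(z <- s) bitlen z)%N.

Definition computable (f : nat -> nat) : Prop :=
  exists p : program, forall k : nat,
  exists (c : nat) (m : memory),
    exec p (load [:: k%:Z]) c m /\ m 0%N = (f k)%:Z.

(** * Parameterized problems *)

Record param_problem := ParamProblem {
  pinstance : Type;
  encode : pinstance -> seq int;
  parameter : pinstance -> nat;
  yes : pinstance -> Prop
}.

(* The answer is left in cell 0. *)
Definition FPT (P : param_problem) : Prop :=
  exists (p : program) (f : nat -> nat) (d : nat),
    computable f /\
    forall x : pinstance P,
    exists (c : nat) (m : memory),
      [/\ exec p (load (encode x)) c m,
          yes x -> m 0%N = 1,
          ~ yes x -> m 0%N = 0 &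
          (c <= f (parameter x) * bitsize (encode x) ^ d)%N].

(** * Weighted digraphs *)

(* [D u v] is [Some w] when [(u, v)] is an edge of weight [w], and [None] when
   it is not an edge. *)
Definition wdigraph (W : Type) (n : nat) := 'I_n -> 'I_n -> option W.

Definition edge (W : Type) (n : nat) (D : wdigraph W n) : rel 'I_n :=
  fun u v => isSome (D u v).

(* Total weight of the edges joining consecutive vertices of [p]. *)
Definition weight (n : nat) (D : wdigraph int n) (p : seq 'I_n) : int :=
  \sum_(e <- zip p (behead p)) odflt 0 (D e.1 e.2).

Definition no_negative_cycle (n : nat) (D : wdigraph int n) : Prop :=
  forall (x : 'I_n) (p : seq 'I_n),
    uniq (x :: p) -> cycle (edge D) (x :: p) -> 0 <= weight D (x :: rcons p x).

Definition st_path (n : nat) (D : wdigraph int n) (s t : 'I_n)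
    (p : seq 'I_n) : Prop :=
  exists q : seq 'I_n,
    [/\ p = s :: q, path (edge D) s q, last s q = t & uniq p].

Definition shortest_st_path (n : nat) (D : wdigraph int n) (s t : 'I_n)
    (p : seq 'I_n) : Prop :=
  st_path D s t p /\
  forall p' : seq 'I_n, st_path D s t p' -> weight D p <= weight D p'.

(** * Token moves *)

(* [moves M T c T'] : some sequence of moves of total cost [c] turns [T] into
   [T']. *)
Inductive moves (n : nat) (M : wdigraph nat n) :
    {mset 'I_n} -> nat -> {mset 'I_n} -> Prop :=
| moves_refl T : moves M T 0 T
| moves_step (T : {mset 'I_n}) (x y : 'I_n) w c T' :
    x \in T -> M x y = Some w -> moves M (y +` (T `\ x)) c T' ->
    moves M T (w + c) T'.

Definition reachable (n : nat) (M : wdigraph nat n) (S : {mset 'I_n}) (b : int)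
    (T : {mset 'I_n}) : Prop :=
  exists c : nat, moves M S c T /\ c%:Z <= b.

(** * The discovery problems *)

Record instance := Instance {
  num_vertices : nat;
  problem_graph : wdigraph int num_vertices;
  movement_graph : wdigraph nat num_vertices;
  source : 'I_num_vertices;
  target : 'I_num_vertices;
  tokens : {mset 'I_num_vertices};
  budget : int;
  source_neq_target : source != target;
  problem_graph_no_negative_cycle : no_negative_cycle problem_graph
}.

Arguments problem_graph : clear implicits.
Arguments movement_graph : clear implicits.

Definition num_tokens (I : instance) : nat := size (tokens I).

(* Adjacency matrix in row-major order, two integers per ordered pair. *)
Definition encode_graph (W : Type) (toZ : W -> int) (n : nat)
    (D : wdigraph W n) : seq int :=
  flatten [seq if D u v is Some w then [:: 1; toZ w] else [:: 0; 0]
          | u <- enum 'I_n, v <- enum 'I_n].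

(* [tokens I] coerces to the list of its elements, each repeated according to
   its multiplicity. *)
Definition encode_instance (I : instance) : seq int :=
  [:: (num_vertices I)%:Z; (num_tokens I)%:Z;
      (source I : nat)%:Z; (target I : nat)%:Z; budget I]
  ++ encode_graph id (problem_graph I)
  ++ encode_graph Posz (movement_graph I)
  ++ [seq (v : nat)%:Z | v : 'I_(num_vertices I) <- tokens I].

Definition path_discovery : param_problem := {|
  pinstance := instance;
  encode := encode_instance;
  parameter := num_tokens;
  yes := fun I =>
    exists (T : {mset 'I_(num_vertices I)}) (p : seq 'I_(num_vertices I)),
      [/\ reachable (movement_graph I) (tokens I) (budget I) T,
          st_path (problem_graph I) (source I) (target I) p &
          {subset p <= T}]
|}.

Definition shortest_path_discovery : param_problem := {|
  pinstance := instance;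
  encode := encode_instance;
  parameter := num_tokens;
  yes := fun I =>
    exists (T : {mset 'I_(num_vertices I)}) (p : seq 'I_(num_vertices I)),
      [/\ reachable (movement_graph I) (tokens I) (budget I) T,
          shortest_st_path (problem_graph I) (source I) (target I) p &
          {subset p <= T}]
|}.

(* Main.v *)
Require Import Defs.
From mathcomp Require Import all_boot all_order all_algebra finmap multiset zify.

Set Implicit Arguments.
Unset Strict Implicit.
Unset Printing Implicit Defensive.

Import Order.TTheory GRing.Theory Num.Theory.

Local Open Scope ring_scope.

(* Since movement costs are nonnegative, it suffices to find a cheap walk from
   [s] to [t] occupied by distinct tokens: shortcutting it to a path only frees
   tokens. A dynamic program over pairs (set of used tokens, last vertex) finds
   the cheapest such walk in time [2 ^ k] times a polynomial, from the distances
   of the movement graph. For shortest paths, the walk is confined to the tight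
   edges, those with [dist u + w = dist v] for the distances from [s]: a path is
   shortest iff all of its edges are tight. Plain paths are the special case where
   all weights of the problem graph are replaced by 0.

   On the machine, a step at most multiplies the largest value by a constant, so
   the logarithmic cost of [t] steps is polynomial in [t] and the input size, and
   only steps need to be counted. *)

Inductive uexec : program -> memory -> nat -> memory -> Prop :=
| uexec_skip m : uexec Skip m 1 m
| uexec_write m a e :
    uexec (Write a e) m 1 (update m `|eval m a|%N (eval m e))
| uexec_seq p q m c1 m1 c2 m2 :
    uexec p m c1 m1 -> uexec q m1 c2 m2 -> uexec (Seq p q) m (c1 + c2) m2
| uexec_if_true e p q m c m' :
    0 < eval m e -> uexec p m c m' -> uexec (If e p q) m (1 + c) m'
| uexec_if_false e p q m c m' :
    eval m e <= 0 -> uexec q m c m' -> uexec (If e p q) m (1 + c) m'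
| uexec_while_true e p m c1 m1 c2 m2 :
    0 < eval m e -> uexec p m c1 m1 -> uexec (While e p) m1 c2 m2 ->
    uexec (While e p) m (1 + c1 + c2) m2
| uexec_while_false e p m :
    eval m e <= 0 -> uexec (While e p) m 1 m.

Fixpoint esize (e : expr) : nat :=
  match e with
  | Cst z => (bitlen z).+1
  | Get e1 => (esize e1).+1
  | Plus e1 e2 | Minus e1 e2 => (esize e1 + esize e2).+1
  end.

Fixpoint psize (p : program) : nat :=
  match p with
  | Skip => 0
  | Write a e => esize a + esize e
  | Seq p q => psize p + psize q
  | If e p q => esize e + psize p + psize q
  | While e p => esize e + psize p
  end.

Definition mbound (m : memory) (l : nat) := forall i, (`|m i| <= 2 ^ l)%N.

Lemma mboundW m l l' : (l <= l')%N -> mbound m l -> mbound m l'.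
Proof. by move=> ll' ml i; rewrite (leq_trans (ml i)) ?leq_exp2l. Qed.

Lemma bitlen_gt z : (`|z| < 2 ^ bitlen z)%N.
Proof. by rewrite /bitlen trunc_log_ltn. Qed.

Lemma bitlen_le z l : (`|z| <= 2 ^ l)%N -> (bitlen z <= l.+1)%N.
Proof.
rewrite /bitlen ltnS => zl; case: (posnP `|z|%N) => [->|z0].
  by rewrite trunc_log0.
rewrite -(leq_exp2l (m := 2)) //; apply: leq_trans zl.
exact: trunc_logP.
Qed.

Lemma eval_bound m l e : mbound m l -> (`|eval m e| <= 2 ^ (l + esize e))%N.
Proof.
move=> ml; elim: e => [z|e IH|e1 IH1 e2 IH2|e1 IH1 e2 IH2] /=.
- by rewrite (leq_trans (ltnW (bitlen_gt z))) // leq_exp2l //; lia.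
- by rewrite (leq_trans (ml _)) // leq_exp2l // leq_addr.
all: rewrite addnS expnS mul2n -addnn.
all: apply: (@leq_trans (`|eval m e1| + `|eval m e2|)%N); first by lia.
all: apply: leq_add; [apply: leq_trans IH1 _|apply: leq_trans IH2 _];
  rewrite leq_exp2l //; lia.
Qed.

Lemma ecost_bound m l e S : mbound m l -> (esize e <= S)%N ->
  (ecost m e <= esize e * (l + S).+1)%N.
Proof.
move=> ml.
have B e' : (esize e' <= S)%N -> (bitlen (eval m e') <= (l + S).+1)%N.
  move=> es; apply: bitlen_le; apply: leq_trans (eval_bound e' ml) _.
  by rewrite leq_exp2l ?leq_add2l.
elim: e => [z|e IH|e1 IH1 e2 IH2|e1 IH1 e2 IH2] es; move: (B _ es) => /= b;
  rewrite /= in es.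
- by rewrite addn0 (leq_trans b) // leq_pmull.
- by rewrite mulSn leq_add // IH // ltnW.
all: rewrite mulSn mulnDl leq_add // leq_add // ?IH1 ?IH2 //; lia.
Qed.

Lemma update_bound m l a z : mbound m l -> (`|z| <= 2 ^ l)%N ->
  mbound (update m a z) l.
Proof. by move=> ml zl i; rewrite /update; case: eqP. Qed.

(* A unit step at most multiplies the largest value by [2 ^ S]. *)
Lemma uexec_exec p m t m' S l : uexec p m t m' -> (psize p <= S)%N ->
  mbound m l -> mbound m' (l + S * t) /\
  exists2 c, exec p m c m' & (c <= t * (1 + S * (l + S * t + S).+1))%N.
Proof.
move=> H; elim: H l => {p m t m'}
 [m|m a e|p q m c1 m1 c2 m2 _ IH1 _ IH2|e p q m c m' e0 _ IH|e p q m c m' e0 _ IH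
 |e p m c1 m1 c2 m2 e0 _ IH1 _ IH2|e p m e0] l /= ps ml.
- split; first by apply: mboundW ml; rewrite leq_addr.
  by exists 1%N; [exact: exec_skip | lia].
- split.
    apply: update_bound; first by apply: mboundW ml; rewrite leq_addr.
    apply: leq_trans (eval_bound e ml) _; rewrite leq_exp2l //; lia.
  exists (1 + ecost m a + ecost m e)%N; first exact: exec_write.
  have ea : (esize a <= S)%N by lia.
  have ee : (esize e <= S)%N by lia.
  have := ecost_bound ml ea; have := ecost_bound ml ee.
  rewrite mul1n -addnA leq_add2l => h1 h2.
  apply: leq_trans (leq_add h2 h1) _; rewrite -mulnDl leq_mul //; lia.
- have [pp pq] : (psize p <= S /\ psize q <= S)%N by lia.
  have [b1 [d1 x1 l1]] := IH1 l pp ml.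
  have [b2 [d2 x2 l2]] := IH2 _ pq b1.
  split; first by rewrite mulnDr addnA.
  exists (d1 + d2)%N; first exact: exec_seq x1 x2.
  rewrite mulnDl leq_add //.
    by apply: leq_trans l1 _; rewrite leq_mul2l leq_add2l leq_mul2l; lia.
  by apply: leq_trans l2 _; rewrite leq_mul2l leq_add2l leq_mul2l; lia.
1,2: have pp : (psize p <= S /\ psize q <= S)%N by lia.
1,2: have [b1 [d1 x1 l1]] := IH l ltac:(by case: pp) ml.
1,2: (split; first by apply: mboundW b1; lia).
1,2: exists (1 + ecost m e + d1)%N; [by constructor|].
1,2: have ee : (esize e <= S)%N by lia.
1,2: rewrite mulnDl leq_add //; last
  by apply: leq_trans l1 _; rewrite leq_mul2l leq_add2l leq_mul2l; lia.
1,2: rewrite mul1n leq_add2l; apply: leq_trans (ecost_bound ml ee) _;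
  rewrite leq_mul //; lia.
- have pp : (psize p <= S)%N by lia.
  have [b1 [d1 x1 l1]] := IH1 l pp ml.
  have [b2 [d2 x2 l2]] := IH2 _ ps b1.
  split; first by apply: mboundW b2; lia.
  exists (1 + ecost m e + d1 + d2)%N; first exact: exec_while_true x1 x2.
  have ee : (esize e <= S)%N by lia.
  rewrite !mulnDl leq_add //; last
    by apply: leq_trans l2 _; rewrite leq_mul2l leq_add2l leq_mul2l; lia.
  rewrite leq_add //; last
    by apply: leq_trans l1 _; rewrite leq_mul2l leq_add2l leq_mul2l; lia.
  rewrite mul1n leq_add2l; apply: leq_trans (ecost_bound ml ee) _;
    rewrite leq_mul //; lia.
- split; first by apply: mboundW ml; rewrite leq_addr.
  exists (1 + ecost m e)%N; first exact: exec_while_false.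
  have ee : (esize e <= S)%N by lia.
  rewrite mul1n leq_add2l; apply: leq_trans (ecost_bound ml ee) _;
    rewrite leq_mul //; lia.
Qed.

(** * A language with arrays and bounded loops *)

(* [state] maps an array index and a position to a value; a scalar variable is
   an array used at position 0 only. *)
Definition state := nat -> nat -> int.

Definition upd (s : state) (j i : nat) (z : int) : state :=
  fun j' => if j' == j then fun i' => if i' == i then z else s j' i' else s j'.

Inductive aexp :=
| EC of int
| EA of nat & aexp
| EI of aexp
| EAdd of aexp & aexp
| ESub of aexp & aexp.

Local Notation EV j := (EA j (EC 0)).

Inductive acom :=
| ASkip
| ASet of nat & aexp & aexp
| ASeq of acom & acom
| AIf of aexp & acom & acom
| AFor of nat & nat & acom.

Fixpoint mods (c : acom) : seq nat :=
  match c with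
  | ASkip => [::]
  | ASet j _ _ => [:: j]
  | ASeq c1 c2 | AIf _ c1 c2 => mods c1 ++ mods c2
  | AFor x _ c => x :: mods c
  end.

Section Language.

(* The arrays are interleaved above the address [F]: position [i] of array [j]
   has address [F + J * i + j]. Cell 5 is scratch, cell 6 contains [F]. *)
Variables (J : nat) (inp : nat -> int) (F B : nat).

Fixpoint aeval (s : state) (e : aexp) : int :=
  match e with
  | EC z => z
  | EA j e => s j `|aeval s e|%N
  | EI e => inp `|aeval s e|%N
  | EAdd e1 e2 => aeval s e1 + aeval s e2
  | ESub e1 e2 => aeval s e1 - aeval s e2
  end.

Fixpoint asafe (s : state) (e : aexp) : Prop :=
  match e with
  | EC z => True
  | EA j e => asafe s e /\ 0 <= aeval s e
  | EI e => [/\ asafe s e, (`|aeval s e| < F)%N & `|aeval s e|%N \notin [:: 5; 6]]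
  | EAdd e1 e2 | ESub e1 e2 => asafe s e1 /\ asafe s e2
  end.

Fixpoint awf (e : aexp) : bool :=
  match e with
  | EC z => true
  | EA j e => (j < J)%N && awf e
  | EI e => awf e
  | EAdd e1 e2 | ESub e1 e2 => awf e1 && awf e2
  end.

Fixpoint wf (c : acom) : bool :=
  match c with
  | ASkip => true
  | ASet j a e => [&& (j < J)%N, awf a & awf e]
  | ASeq c1 c2 => wf c1 && wf c2
  | AIf e c1 c2 => [&& awf e, wf c1 & wf c2]
  | AFor x y c => [&& (x < J)%N, (y < J)%N, x \notin mods c,
                      y \notin x :: mods c & wf c]
  end.

Fixpoint den (c : acom) (s : state) : state :=
  match c with
  | ASkip => s
  | ASet j a e => upd s j `|aeval s a|%N (aeval s e)
  | ASeq c1 c2 => den c2 (den c1 s)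
  | AIf e c1 c2 => if 0 < aeval s e then den c1 s else den c2 s
  | AFor x y c => iteri `|s y 0%N|%N
                    (fun i t => upd (den c t) x 0 i.+1%:Z) (upd s x 0 0)
  end.

Fixpoint safe (c : acom) (s : state) : Prop :=
  match c with
  | ASkip => True
  | ASet j a e => [/\ asafe s a, 0 <= aeval s a & asafe s e]
  | ASeq c1 c2 => safe c1 s /\ safe c2 (den c1 s)
  | AIf e c1 c2 => asafe s e /\ (if 0 < aeval s e then safe c1 s else safe c2 s)
  | AFor x y c => 0 <= s y 0%N <= B%:Z /\ forall i, (i < `|s y 0%N|)%N ->
      safe c (iteri i (fun i t => upd (den c t) x 0 i.+1%:Z) (upd s x 0 0))
  end.

Lemma den_frame c s j : j \notin mods c -> den c s j = s j.
Proof.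
elim: c s => [|j' a e|c1 IH1 c2 IH2|e c1 IH1 c2 IH2|x y c IH] s //=.
- by rewrite inE /upd => /negPf->.
- by rewrite mem_cat negb_or => /andP[h1 h2]; rewrite IH2 // IH1.
- by rewrite mem_cat negb_or => /andP[h1 h2]; case: ifP; rewrite ?IH2 ?IH1.
- rewrite inE negb_or => /andP[/negPf jx jc].
  elim: `|_|%N => /= [|n IHn]; first by rewrite /upd jx.
  by rewrite /upd jx IH.
Qed.

Definition rep (m : memory) (s : state) :=
  [/\ m 6%N = F%:Z,
      forall j i, (j < J)%N -> m (F + (J * i + j))%N = s j i &
      forall a, (a < F)%N -> a \notin [:: 5; 6] -> m a = inp a].

Fixpoint mulexpr (n : nat) (e : expr) : expr :=
  if n is n'.+1 then Plus e (mulexpr n' e) else Cst 0.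

Definition addr (j : nat) (e : expr) : expr :=
  Plus (Get (Cst 6)) (Plus (mulexpr J e) (Cst j%:Z)).

Fixpoint cexp (e : aexp) : expr :=
  match e with
  | EC z => Cst z
  | EA j e => Get (addr j (cexp e))
  | EI e => Get (cexp e)
  | EAdd e1 e2 => Plus (cexp e1) (cexp e2)
  | ESub e1 e2 => Minus (cexp e1) (cexp e2)
  end.

Fixpoint compile (c : acom) : program :=
  match c with
  | ASkip => Skip
  | ASet j a e => Write (addr j (cexp a)) (cexp e)
  | ASeq c1 c2 => Seq (compile c1) (compile c2)
  | AIf e c1 c2 => If (cexp e) (compile c1) (compile c2)
  | AFor x y c =>
      Seq (Write (addr x (Cst 0)) (Cst 0))
          (While (cexp (ESub (EV y) (EV x)))
             (Seq (compile c)
                  (Write (addr x (Cst 0)) (cexp (EAdd (EV x) (EC 1))))))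
  end.

Lemma eval_mulexpr m n e : eval m (mulexpr n e) = n%:Z * eval m e.
Proof. by elim: n => [|n IH] /=; rewrite ?mul0r // IH intS mulrDl mul1r. Qed.

Lemma eval_addr m s j e i : rep m s -> eval m e = i%:Z ->
  eval m (addr j e) = (F + (J * i + j))%N.
Proof.
case=> m6 _ _ ei; rewrite /= eval_mulexpr ei [m _]m6.
by rewrite !PoszD PoszM.
Qed.

Lemma eval_cexp m s e : rep m s -> awf e -> asafe s e ->
  eval m (cexp e) = aeval s e.
Proof.
move=> ms; elim: e => [z|j e IH|e IH|e1 IH1 e2 IH2|e1 IH1 e2 IH2] //.
- move=> /= /andP[jJ we] [se e0].
  have /(eval_addr j ms) E : eval m (cexp e) = `|aeval s e|%N.
    by rewrite IH // gez0_abs.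
  by rewrite -[LHS]/(m `|eval m (addr j (cexp e))|%N) E; case: ms => _ ->.
- by move=> /= we [se eF e56]; rewrite IH //; case: ms => _ _ ->.
- by move=> /= /andP[? ?] [? ?]; rewrite IH1 ?IH2.
- by move=> /= /andP[? ?] [? ?]; rewrite IH1 ?IH2.
Qed.

Hypothesis F_gt6 : (6 < F)%N.

Lemma rep_upd m s j i z : (j < J)%N -> rep m s ->
  rep (update m (F + (J * i + j)) z) (upd s j i z).
Proof.
move=> jJ [m6 mF mi]; rewrite /update; split.
- by case: eqP => // E; exfalso; lia.
- move=> j' i' j'J; rewrite /upd eqn_add2l.
  case: (eqVneq j' j) => [->|jj'].
    rewrite eqn_add2r eqn_mul2l.
    have -> /= : (J == 0%N) = false by apply/negbTE; lia.
    by case: (i' =P i) => // _; rewrite mF.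
  case: eqP => [E|_]; last exact: mF.
  case/eqP: jj'; have := congr1 (modn^~ J) E.
  by rewrite !(mulnC J) !modnMDl !modn_small.
- move=> a aF a56; case: eqP => [E|_]; last exact: mi.
  by exfalso; lia.
Qed.

Lemma uexec_set m s j a e : rep m s -> wf (ASet j a e) -> safe (ASet j a e) s ->
  exists2 m', uexec (compile (ASet j a e)) m 1 m' & rep m' (den (ASet j a e) s).
Proof.
move=> ms /= /and3P[jJ wa we] [sa a0 se]; eexists; first exact: uexec_write.
rewrite (eval_cexp ms) // (@eval_addr _ s _ _ `|aeval s a|%N) //.
  by rewrite absz_nat; exact: rep_upd.
by rewrite (eval_cexp ms) // gez0_abs.
Qed.

Fixpoint tb (c : acom) : nat :=
  match c with
  | ASkip | ASet _ _ _ => 1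
  | ASeq c1 c2 => tb c1 + tb c2
  | AIf e c1 c2 => 1 + (tb c1 + tb c2)
  | AFor x y c => 2 + B * (tb c + 2)
  end.

Lemma iteri_frame x c s j i : j \notin x :: mods c ->
  iteri i (fun i t => upd (den c t) x 0 i.+1%:Z) (upd s x 0 0) j = s j.
Proof.
rewrite inE negb_or => /andP[/negPf jx jc].
elim: i => /= [|i IHi]; first by rewrite /upd jx.
by rewrite /upd jx den_frame.
Qed.

Lemma iteri_counter x c s i :
  iteri i (fun i t => upd (den c t) x 0 i.+1%:Z) (upd s x 0 0) x 0%N = i.
Proof. by case: i => [|i]; rewrite /= /upd !eqxx. Qed.

Lemma compileP c m s : wf c -> rep m s -> safe c s ->
  exists t m', [/\ uexec (compile c) m t m', rep m' (den c s) & (t <= tb c)%N].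
Proof.
elim: c m s => [|j a e|c1 IH1 c2 IH2|e c1 IH1 c2 IH2|x y c IH] m s.
- by move=> _ ms _; exists 1%N, m; split=> //; exact: uexec_skip.
- move=> w ms sa; have [m' ? ?] := uexec_set ms w sa.
  by exists 1%N, m'.
- move=> /= /andP[w1 w2] ms [s1 s2].
  have [t1 [m1 [x1 r1 l1]]] := IH1 _ _ w1 ms s1.
  have [t2 [m2 [x2 r2 l2]]] := IH2 _ _ w2 r1 s2.
  exists (t1 + t2)%N, m2; split=> //; first exact: uexec_seq x1 x2.
  exact: leq_add.
- move=> /= /and3P[we w1 w2] ms [se sc].
  have E := eval_cexp ms we se.
  case: ifPn sc => e0 sc.
    have [t1 [m1 [x1 r1 l1]]] := IH1 _ _ w1 ms sc.
    exists (1 + t1)%N, m1; split=> //; last by lia.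
    by apply: uexec_if_true; rewrite ?E.
  have [t1 [m1 [x1 r1 l1]]] := IH2 _ _ w2 ms sc.
  exists (1 + t1)%N, m1; split=> //; last by lia.
  by apply: uexec_if_false; rewrite ?E // leNgt.
move=> w ms sc.
case/and5P: (w) => xJ yJ xc yxc wc; case: sc => /andP[y0 yB] sc.
set N := `|s y 0%N|%N in sc.
pose st i := iteri i (fun i t => upd (den c t) x 0 i.+1%:Z) (upd s x 0 0).
have [||m0 u0 r0] := @uexec_set m s x (EC 0) (EC 0) ms.
- by rewrite /= xJ.
- by [].
have NB : (N <= B)%N by rewrite /N; lia.
have styN i : st i y 0%N = N by rewrite /st iteri_frame // /N gez0_abs.
have guard k mk : rep mk (st k) ->
    eval mk (cexp (ESub (EV y) (EV x))) = N%:Z - k%:Z.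
  move=> rk; rewrite (eval_cexp rk) /=; [|by rewrite yJ xJ|by []].
  by rewrite styN /st iteri_counter.
have loop d k mk : (k + d)%N = N -> rep mk (st k) ->
  exists t m', [/\ uexec (While (cexp (ESub (EV y) (EV x)))
             (Seq (compile c)
                  (Write (addr x (Cst 0)) (cexp (EAdd (EV x) (EC 1)))))) mk t m',
    rep m' (st N) & (t <= 1 + d * (tb c + 2))%N].
  elim: d k mk => [|d IHd] k mk.
    rewrite addn0 => kN rk; exists 1%N, mk; split; last by [].
    - by apply: uexec_while_false; rewrite (guard _ _ rk) kN subrr.
    - by rewrite -kN.
  move=> kd rk.
  have kN : (k < N)%N by lia.
  have [t1 [m1 [x1 r1 l1]]] := IH _ _ wc rk (sc _ kN).
  have [||m2 u2 r2] := @uexec_set m1 (den c (st k)) x (EC 0) (EAdd (EV x) (EC 1)) r1.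
  - by rewrite /= xJ.
  - by [].
  have r2' : rep m2 (st k.+1).
    move: r2; rewrite /= den_frame // [st k x 0%N]iteri_counter.
    by rewrite [k%:Z + 1]addrC -intS.
  have [t3 [m3 [x3 r3 l3]]] := IHd k.+1 m2 ltac:(by lia) r2'.
  exists (1 + (t1 + 1) + t3)%N, m3; split=> //; last by rewrite mulSn; lia.
  apply: uexec_while_true x3; last exact: uexec_seq x1 u2.
  by rewrite (guard _ _ rk) subr_gt0 ltz_nat.
have [t [m' [x1 r1 l1]]] := loop N 0%N m0 (add0n _) r0.
exists (1 + t)%N, m'; split=> //=.
- by apply: uexec_seq x1; exact: u0.
- have : (N * (tb c + 2) <= B * (tb c + 2))%N by rewrite leq_mul2r NB orbT.
  lia.
Qed.

End Language.

Fixpoint csize (c : acom) : nat :=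
  match c with
  | ASkip | ASet _ _ _ => 1
  | ASeq c1 c2 | AIf _ c1 c2 => (csize c1 + csize c2).+1
  | AFor _ _ c => csize c + 4
  end.

Lemma tb_poly B c : (tb B c <= csize c * B.+1 ^ csize c)%N.
Proof.
have E0 n : (0 < B.+1 ^ n)%N by rewrite expn_gt0.
have Ele a b : (a <= b -> B.+1 ^ a <= B.+1 ^ b)%N by move=> ?; rewrite leq_pexp2l.
elim: c => [|j a e|c1 IH1 c2 IH2|e c1 IH1 c2 IH2|x y c IH] /=.
- by rewrite mul1n E0.
- by rewrite mul1n E0.
1,2: rewrite mulSn mulnDl.
1,2: have h1 : (tb B c1 <= csize c1 * B.+1 ^ (csize c1 + csize c2).+1)%N
  by apply: leq_trans IH1 _; rewrite leq_mul2l Ele ?orbT //; lia.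
1,2: have h2 : (tb B c2 <= csize c2 * B.+1 ^ (csize c1 + csize c2).+1)%N
  by apply: leq_trans IH2 _; rewrite leq_mul2l Ele ?orbT //; lia.
1,2: have := E0 (csize c1 + csize c2).+1; lia.
have h1 : (B.+1 * tb B c <= csize c * B.+1 ^ (csize c + 4))%N.
  apply: (@leq_trans (B.+1 * (csize c * B.+1 ^ csize c))%N).
    by rewrite leq_mul2l IH orbT.
  by rewrite mulnCA -expnS leq_mul2l Ele ?orbT //; lia.
have h2 : (B.+1 <= B.+1 ^ (csize c + 4))%N.
  by rewrite -[X in (X <= _)%N]expn1 Ele //; lia.
rewrite mulnDl; move: h1 h2; rewrite mulSn; lia.
Qed.

(** * Walks and shortest paths *)

Inductive wk (n : nat) (D : wdigraph int n) (u : 'I_n) : nat -> 'I_n -> int -> Prop :=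
| wk_nil : wk D u 0 u 0
| wk_rcons r v c v' w :
    wk D u r v c -> D v v' = Some w -> wk D u r.+1 v' (c + w).

Section Walks.

Variables (n : nat) (D : wdigraph int n).
Implicit Types (u v x s t : 'I_n) (p q : seq 'I_n).

Lemma weight1 u : weight D [:: u] = 0.
Proof. by rewrite /weight /= big_nil. Qed.

Lemma weight_cons u v q :
  weight D (u :: v :: q) = odflt 0 (D u v) + weight D (v :: q).
Proof. by rewrite /weight /= big_cons. Qed.

Lemma weight_cat p x q :
  weight D (p ++ x :: q) = weight D (rcons p x) + weight D (x :: q).
Proof.
elim: p => [|y [|z p] IH] /=; first by rewrite weight1 add0r.
  by rewrite !weight_cons weight1 addr0.
by rewrite !weight_cons -addrA -IH.
Qed.

Lemma weight_rcons u q v :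
  weight D (u :: rcons q v) = weight D (u :: q) + odflt 0 (D (last u q) v).
Proof.
elim/last_ind: q => [|q w _]; first by rewrite /= weight_cons !weight1 addr0 add0r.
rewrite last_rcons -!rcons_cons (_ : rcons _ v = (u :: q) ++ [:: w; v]).
  by rewrite weight_cat weight_cons weight1 addr0.
by rewrite -!cats1 -catA.
Qed.

Lemma path_wk u q : path (edge D) u q -> wk D u (size q) (last u q) (weight D (u :: q)).
Proof.
elim/last_ind: q => [|q v IH]; first by rewrite weight1; constructor.
rewrite rcons_path weight_rcons size_rcons last_rcons => /andP[/IH pq].
by rewrite /edge; case E: (D _ v) => [w|] // _; apply: wk_rcons E.
Qed.

Lemma wk_cons u v w r x c : D u v = Some w -> wk D v r x c -> wk D u r.+1 x (w + c).
Proof.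
move=> uv; elim=> [|r' v' c' v'' w' _ IH E].
  by rewrite addr0 -[w]add0r; apply: wk_rcons uv; constructor.
by rewrite addrA; apply: wk_rcons E.
Qed.

Hypothesis D0 : no_negative_cycle D.

(* The last edge either extends the simple path or closes a simple cycle, which
   can be dropped. *)
Lemma wk_simple u r v c : wk D u r v c -> exists q,
  [/\ path (edge D) u q, last u q = v, uniq (u :: q) & weight D (u :: q) <= c].
Proof.
elim=> [|{}r {}v {}c v' w _ [q [pq lq uq wq]] E].
  by exists [::]; split=> //; rewrite weight1.
case: (boolP (v' \in u :: q)) => v'q; last first.
  exists (rcons q v'); split.
  - by rewrite rcons_path pq lq /edge E.
  - by rewrite last_rcons.
  - by rewrite -rcons_cons rcons_uniq v'q uq.
  - by rewrite weight_rcons lq E lerD2r.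
have cyc q1 q2 : u :: q = q1 ++ v' :: q2 -> 0 <= weight D (v' :: q2) + w.
  move=> Eq.
  have lq2 : last v' q2 = v by rewrite -lq -[last u q]/(last u (u :: q)) Eq last_cat.
  have := D0 (x := v') (p := q2).
  rewrite -[w]/(odflt 0 (Some w)) -E -lq2 -weight_rcons; apply.
    by move: uq; rewrite Eq cat_uniq => /and3P[].
  rewrite /= rcons_path lq2 /edge E andbT.
  have : sorted (edge D) (u :: q) by [].
  by rewrite Eq => /cat_sorted2[].
have [q1 [q2 [Eq]]] : exists q1 q2, u :: q = q1 ++ v' :: q2.
  by case/splitPr: v'q => q1 q2; exists q1, q2.
have := cyc _ _ Eq.
have : sorted (edge D) (u :: q) by [].
have := uq; have := wq; rewrite Eq weight_cat -cat_rcons.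
move=> wq' uq' /cat_sorted2[sq1 _] c0.
have : uniq (rcons q1 v') by move: uq'; rewrite cat_uniq => /and3P[].
have : weight D (rcons q1 v') <= c + w by lia.
have : head u (rcons q1 v') = u.
  by have := congr1 (head u) Eq; rewrite -cat_rcons; case: (q1).
have : last u (rcons q1 v') = v' by rewrite last_rcons.
move: sq1; case: (rcons q1 v') (size_rcons q1 v') => //=.
move=> a q3 _ pq3 lq3 au; rewrite au in pq3 lq3 * => wq3 uq3.
by exists q3.
Qed.

Lemma wk_short u r v c : wk D u r v c ->
  exists r' c', [/\ (r' <= n)%N, c' <= c & wk D u r' v c'].
Proof.
case/wk_simple=> q [pq lq uq wq]; exists (size q), (weight D (u :: q)); split=> //.
  by have := max_card (mem (u :: q)); rewrite (card_uniqP uq) card_ord => /ltnW.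
by rewrite -lq; apply: path_wk.
Qed.

Variables (s : 'I_n) (dist : 'I_n -> option int).
Hypothesis dist_wk : forall v d, dist v = Some d -> exists r, wk D s r v d.
Hypothesis dist_min : forall v r c, wk D s r v c -> exists2 d, dist v = Some d & d <= c.

Definition tight : rel 'I_n := fun u v =>
  match D u v, dist u, dist v with
  | Some w, Some du, Some dv => du + w <= dv
  | _, _, _ => false
  end.

Lemma dist_source : dist s = Some 0.
Proof.
have [d Ed d0] := dist_min (wk_nil D s).
have [r /wk_simple[[|v q] [_ lq uq wq]]] := dist_wk Ed.
  by move: wq; rewrite weight1 Ed => wq; congr Some; lia.
by move: uq; rewrite cons_uniq -[in s \in _]lq /= mem_last.
Qed.

Lemma dist_edge u v w du : D u v = Some w -> dist u = Some du ->
  exists2 dv, dist v = Some dv & dv <= du + w.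
Proof. by move=> E /dist_wk[r Wr]; apply: dist_min (wk_rcons Wr E). Qed.

Lemma tight_path_dist u q du : dist u = Some du -> path tight u q ->
  dist (last u q) = Some (du + weight D (u :: q)).
Proof.
elim: q u du => [|v q IH] u du Eu /=; first by rewrite weight1 addr0.
rewrite weight_cons /tight Eu; case E: (D u v) => [w|] //=.
have [dv Ev dvw] := dist_edge E Eu; rewrite Ev => /andP[wdv pq].
by rewrite (IH _ _ Ev) // addrA; congr (Some (_ + _)); lia.
Qed.

Lemma dist_path_tight u q du d : dist u = Some du -> path (edge D) u q ->
  dist (last u q) = Some d ->
  d <= du + weight D (u :: q) /\ (du + weight D (u :: q) <= d -> path tight u q).
Proof.
elim: q u du => [|v q IH] u du Eu /=.
  by move=> _; rewrite Eu weight1 addr0 => -[->].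
rewrite weight_cons /edge; case E: (D u v) => [w|] //= pq Ed.
have [dv Ev dvw] := dist_edge E Eu.
have [le1 tq] := IH v dv Ev pq Ed.
split=> [|le2]; first by lia.
rewrite tq; last by lia.
by rewrite andbT /tight E Eu Ev; lia.
Qed.

Lemma tight_edge : subrel tight (edge D).
Proof. by move=> u v; rewrite /tight /edge; case: (D u v). Qed.

(* Reduced weights telescope, so a path is shortest exactly when each of its
   edges is tight. *)
Lemma shortest_tightP t p : shortest_st_path D s t p <->
  exists q, [/\ p = s :: q, path tight s q, last s q = t & uniq p].
Proof.
have E0 := dist_source; split.
  case=> -[q [-> pq lq uq]] pmin; exists q; split=> //.
  have [d Ed dW] := dist_min (path_wk pq).
  have [_] := dist_path_tight E0 pq Ed; apply.
  have [r /wk_simple[q' [pq' lq' uq' wq']]] := dist_wk Ed.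
  rewrite add0r; apply: le_trans wq'; apply: pmin.
  by exists q'; split=> //; rewrite lq'.
case=> q [-> pq lq uq]; split.
  by exists q; split=> //; apply: sub_path pq; apply: tight_edge.
move=> _ [q' [-> pq' lq' _]].
have := tight_path_dist E0 pq; rewrite add0r lq => Et.
have := dist_min (path_wk pq'); rewrite lq' Et => -[d [<-] ?].
by [].
Qed.

End Walks.

(** * Token moves *)

Definition int_graph (n : nat) (M : wdigraph nat n) : wdigraph int n :=
  fun u v => omap Posz (M u v).

Lemma moves_trans n (M : wdigraph nat n) S c T c' U :
  moves M S c T -> moves M T c' U -> moves M S (c + c')%N U.
Proof.
elim=> [//|S' x y w d T' xS E _ IH] TU.
by rewrite -addnA; apply: moves_step xS E (IH TU).
Qed.

Section Moves.

Variables (n : nat) (M : wdigraph nat n) (x0 : 'I_n).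

Lemma seq_mset_set_nth (l : seq 'I_n) i y : (i < size l)%N ->
  seq_mset (set_nth x0 l i y) = (y +` (seq_mset l `\ nth x0 l i))%mset.
Proof.
move=> il; apply/msetP => a.
rewrite mset_seqE count_set_nth_ltn // mset1DE msetB1E mset_seqE /=.
have := mem_nth x0 il; rewrite -has_pred1 has_count.
have : (nth x0 l i == a) ==> (0 < count_mem a l)%N.
  by apply/implyP => /eqP <-; rewrite -has_count has_pred1 mem_nth.
by rewrite [a == y]eq_sym [a == nth _ _ _]eq_sym; case: eqP => /=; case: eqP => /=; lia.
Qed.

Lemma moves_wk (l : seq 'I_n) i r y c : (i < size l)%N ->
    wk (int_graph M) (nth x0 l i) r y c ->
  exists2 c' : nat, c = c'%:Z &
    moves M (seq_mset l) c' (seq_mset (set_nth x0 l i y)).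
Proof.
move=> il; elim=> [|{}r v {}c v' w _ [c' -> IH]].
  exists 0%N => //; rewrite (_ : set_nth _ _ _ _ = l); first by constructor.
  apply: (@eq_from_nth _ x0); first by rewrite size_set_nth; apply/maxn_idPr.
  by move=> j _; rewrite nth_set_nth /=; case: eqP => // ->.
rewrite /int_graph; case E: (M v v') => [w'|] //= [<-].
exists (c' + w')%N; first by rewrite PoszD.
apply: moves_trans IH _; rewrite -[w']addn0.
set l1 := set_nth _ l i v.
have s1 : (i < size l1)%N by rewrite size_set_nth leq_max ltnSn.
have n1 : nth x0 l1 i = v by rewrite nth_set_nth /= eqxx.
apply: (@moves_step _ _ _ v v') E _.
  by rewrite in_mset mset_seqE -has_count has_pred1 -n1 mem_nth.
have -> : (v' +` (seq_mset l1 `\ v))%mset = seq_mset (set_nth x0 l i v').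
  rewrite -{1}n1 -seq_mset_set_nth // /l1.
  by rewrite set_set_nth eqxx.
exact: moves_refl.
Qed.

Lemma wk_moves (l : seq 'I_n) c T : moves M (seq_mset l) c T ->
  exists (l' : seq 'I_n) (cs : nat -> nat),
    [/\ size l' = size l, seq_mset l' = T,
        forall i, (i < size l)%N ->
          exists r, wk (int_graph M) (nth x0 l i) r (nth x0 l' i) (cs i)
      & (\sum_(i <- iota 0 (size l)) cs i = c)%N].
Proof.
move E: (seq_mset l) => S mv; elim: mv l E => {S c T}
  [T|S x y w c T xS E _ IH] l El.
  exists l, (fun _ => 0%N); split=> //; last by rewrite big1_eq.
  by move=> i il; exists 0%N; constructor.
have il : (index x l < size l)%N.
  by rewrite index_mem; move: xS; rewrite -El in_mset mset_seqE -has_count has_pred1.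
have nl : nth x0 l (index x l) = x by rewrite nth_index -?index_mem.
set i0 := index x l in il nl.
case: (IH (set_nth x0 l i0 y)); first by rewrite seq_mset_set_nth // nl El.
have -> : size (set_nth x0 l i0 y) = size l.
  by rewrite size_set_nth; apply/maxn_idPr.
move=> l' [cs [sl' <- wl' <-]].
exists l', (fun i => if i == i0 then w + cs i else cs i)%N; split=> //.
  move=> i il'; have [r] := wl' i il'; rewrite nth_set_nth /=.
  case: eqP => [-> Wr|_ Wr]; last by exists r.
  exists r.+1; rewrite PoszD; apply: wk_cons Wr.
  by rewrite nl /int_graph E.
have i0l : i0 \in iota 0 (size l) by rewrite mem_iota.
rewrite (bigD1_seq _ i0l (iota_uniq _ _)) [in RHS](bigD1_seq _ i0l (iota_uniq _ _)) /=.
rewrite eqxx addnA; congr (_ + _)%N.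
by apply: eq_bigr => i /negPf->.
Qed.

Variables (s : 'I_n) (e : rel 'I_n) (tk : seq 'I_n).

(* [ob js v c]: some walk from [s] to [v] in [e] can be occupied, at cost [c],
   by the tokens with the distinct indices [js] (last vertex first). *)
Inductive ob : seq nat -> 'I_n -> int -> Prop :=
| ob_source i r c : (i < size tk)%N -> wk (int_graph M) (nth x0 tk i) r s c ->
    ob [:: i] s c
| ob_step js u c i v r c' : ob js u c -> (i < size tk)%N -> i \notin js ->
    e u v -> wk (int_graph M) (nth x0 tk i) r v c' -> ob (i :: js) v (c + c').

Lemma ob_uniq js v c : ob js v c -> uniq js /\ all (fun i => i < size tk)%N js.
Proof.
elim=> [i r {}c ik _|{}js u {}c i {}v r c' _ [us al] ik ijs _ _] /=.
  by rewrite ik.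
by rewrite ijs ik.
Qed.

Lemma moves_ob js v c : ob js v c -> exists (l : seq 'I_n) (c' : nat) q,
  [/\ c = c'%:Z, size l = size tk, moves M (seq_mset tk) c' (seq_mset l) &
   [/\ path e s q, last s q = v,
      {in s :: q, forall x, exists2 j, j \in js & nth x0 l j = x} &
      forall j, j \notin js -> nth x0 l j = nth x0 tk j]].
Proof.
elim=> [i r {}c ik W|{}js u {}c i {}v r c' O
  [l [c1 [q [-> sl mv [pq lq inl outl]]]]] ik ijs euv W].
  have [c1 -> mv] := moves_wk ik W.
  exists (set_nth x0 tk i s), c1, [::]; split=> //.
    by rewrite size_set_nth; apply/maxn_idPr.
  split=> //.
    move=> x; rewrite inE => /eqP->; exists i; first by rewrite inE.
    by rewrite nth_set_nth /= eqxx.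
  by move=> j; rewrite inE nth_set_nth /= => /negPf->.
have il : (i < size l)%N by rewrite sl.
rewrite -(outl _ ijs) in W.
have [c2 -> mv2] := moves_wk il W.
exists (set_nth x0 l i v), (c1 + c2)%N, (rcons q v); split.
- by rewrite PoszD.
- by rewrite size_set_nth -sl; apply/maxn_idPr.
- exact: moves_trans mv mv2.
split.
- by rewrite rcons_path pq lq.
- by rewrite last_rcons.
- move=> x; rewrite -rcons_cons mem_rcons inE => /orP[/eqP->|xq].
    by exists i; rewrite ?mem_head // nth_set_nth /= eqxx.
  have [j jjs <-] := inl x xq; exists j; first by rewrite inE jjs orbT.
  rewrite nth_set_nth /=; case: eqP => // ji.
  by move: ijs; rewrite -ji jjs.
- move=> j; rewrite inE negb_or nth_set_nth /= => /andP[/negPf-> jjs].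
  exact: outl.
Qed.

Lemma ob_path (l : seq 'I_n) (cs : nat -> nat) q : size l = size tk ->
    (forall i, (i < size tk)%N ->
       exists r, wk (int_graph M) (nth x0 tk i) r (nth x0 l i) (cs i)) ->
    path e s q -> uniq (s :: q) -> {subset s :: q <= l} ->
  ob (rev [seq index x l | x <- s :: q]) (last s q)
     (\sum_(x <- s :: q) cs (index x l))%N%:Z.
Proof.
move=> sl wl; have W x : x \in l -> exists r,
    wk (int_graph M) (nth x0 tk (index x l)) r x (cs (index x l)).
  move=> xl; have ixl : (index x l < size tk)%N by rewrite -sl index_mem.
  by have [r] := wl _ ixl; rewrite nth_index //; exists r.
elim/last_ind: q => [|q v IH] pq uq ql.
  have sl' : s \in l by apply: ql; rewrite inE.
  have [r Wr] := W s sl'.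
  by rewrite big_seq1; apply: ob_source Wr; rewrite -sl index_mem.
move: pq uq ql; rewrite rcons_path last_rcons -rcons_cons rcons_uniq.
move=> /andP[pq ev] /andP[vq uq] ql.
have vl : v \in l by apply: ql; rewrite mem_rcons mem_head.
have ql' : {subset s :: q <= l} by move=> x xq; apply: ql; rewrite mem_rcons inE xq orbT.
have [r Wr] := W v vl.
rewrite map_rcons rev_rcons -cats1 big_cat big_seq1 PoszD.
apply: ob_step (IH pq uq ql') _ _ ev Wr; first by rewrite -sl index_mem.
rewrite mem_rev; apply/mapP => -[x xq].
have xl := ql' _ xq => E.
have := nth_index x0 xl; rewrite -E nth_index // => vx.
by move: vq; rewrite vx xq.
Qed.

(* Shortcutting a walk only frees tokens, so walks may replace paths. *)
Lemma ob_reachableP t b :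
  (exists js c, ob js t c /\ c <= b) <->
  exists T q, [/\ reachable M (seq_mset tk) b T, path e s q, last s q = t,
    uniq (s :: q) & {subset s :: q <= T}].
Proof.
split=> [[js [c [O cb]]]|[T [q [[c [mv cb]] pq lq uq qT]]]].
  have [l [c' [q [cc' sl mv [pq lq inl _]]]]] := moves_ob O.
  have js_lt := (ob_uniq O).2.
  case/shortenP: pq lq => q' pq' uq' qq' lq'.
  exists (seq_mset l), q'; split=> //.
    by exists c'; split=> //; rewrite -cc'.
  move=> x xq'; have : x \in s :: q.
    by move: xq'; rewrite !inE => /orP[->//|/qq'->]; rewrite orbT.
  move=> /inl[j jjs <-]; rewrite in_mset mset_seqE -has_count has_pred1.
  by rewrite mem_nth // sl; exact: (allP js_lt).
have [l [cs [sl ET wl cE]]] := wk_moves mv.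
have ql : {subset s :: q <= l}.
  by move=> x /qT; rewrite -ET in_mset mset_seqE -has_count has_pred1.
have := ob_path sl wl pq uq ql; rewrite lq; set c' := (\sum_(_ <- _) _)%N => O.
exists (rev [seq index x l | x <- s :: q]), c'%:Z; split=> //.
apply: le_trans cb; rewrite lez_nat -cE /c' -(big_map (index^~ l) xpredT cs).
have idx_inj : {in s :: q &, injective (index^~ l)}.
  move=> x y /ql xl /ql yl E.
  by rewrite -(nth_index x0 xl) E nth_index.
apply: (@uniq_sub_le_big _ _ leq) => //.
- by move=> x y; apply: leq_addr.
- by rewrite map_inj_in_uniq.
- exact: iota_uniq.
- by move=> _ /mapP[x /ql xl ->]; rewrite mem_iota /= -sl index_mem.
Qed.

End Moves.

Definition token_mask (js : seq nat) : nat := (\sum_(j <- js) 2 ^ j)%N.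

Lemma token_mask_lt i js : uniq js -> all (fun j => j < i)%N js -> (token_mask js < 2 ^ i)%N.
Proof.
move=> us /allP al; have geo : (\sum_(j <- iota 0 i) 2 ^ j).+1 = (2 ^ i)%N.
  elim: i {al} => [|i IH]; first by rewrite big_nil.
  by rewrite -[in iota 0 i.+1]addn1 iotaD big_cat /= big_seq1 -addSn IH addnn -mul2n expnS.
rewrite -geo ltnS; apply: (@uniq_sub_le_big _ _ leq) => //.
- by move=> x y; apply: leq_addr.
- exact: iota_uniq.
- by move=> j /al; rewrite mem_iota.
Qed.

Lemma token_mask_bit i js : uniq js -> (2 ^ i <= token_mask js %% 2 ^ i.+1)%N = (i \in js).
Proof.
move=> us.
have -> : (token_mask js = \sum_(j <- js | i < j) 2 ^ j + ((i \in js) * 2 ^ i +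
                     token_mask [seq j <- js | j < i]))%N.
  rewrite /token_mask (bigID (fun j => i < j)%N) /= big_filter; congr addn.
  rewrite (bigID (fun j => j == i)) /=; congr addn.
    rewrite (eq_bigl (pred1 i)); last by move=> j /=; case: eqP => [->|]; rewrite ?ltnn ?andbF.
    case: (boolP (i \in js)) => ijs.
      rewrite mul1n -big_filter filter_pred1_uniq // big_seq1 //.
    by rewrite big1_seq // => j /andP[/eqP-> jjs]; rewrite jjs in ijs.
  by apply: eq_bigl => j /=; rewrite -leqNgt andbC -ltn_neqAle.
have /dvdnP[d ->] : (2 ^ i.+1 %| \sum_(j <- js | i < j) 2 ^ j)%N.
  by apply: dvdn_sum => j ij; apply: dvdn_exp2l.
have := @token_mask_lt i [seq j <- js | (j < i)%N] (filter_uniq _ us) (filter_all _ _).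
rewrite modnMDl => lt; rewrite modn_small; last by rewrite expnS; case: (_ \in _); lia.
by case: (_ \in _); lia.
Qed.

(** * Weakest preconditions *)

Section Wp.

Variables (inp : nat -> int) (F B : nat).
Implicit Types (s t : state) (c : acom) (Q : state -> Prop).

Definition wp c s Q := safe inp F B c s /\ Q (den inp c s).

Definition ev s e z := asafe inp F s e /\ aeval inp s e = z.

Definition frame (X : seq nat) s t := forall j, j \notin X -> t j = s j.

Lemma ev_C s z : ev s (EC z) z. Proof. by []. Qed.

Lemma ev_A s j e i z : ev s e i%:Z -> s j i = z -> ev s (EA j e) z.
Proof. by case=> se E sj; split=> /=; rewrite ?E. Qed.

Lemma ev_V s j z : s j 0%N = z -> ev s (EV j) z.
Proof. exact: ev_A. Qed.

Lemma ev_I s e a : ev s e a%:Z -> (a < F)%N -> a \notin [:: 5; 6] ->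
  ev s (EI e) (inp a).
Proof. by case=> se E aF a56; split=> /=; rewrite E. Qed.

Lemma ev_D s e1 e2 x y : ev s e1 x -> ev s e2 y -> ev s (EAdd e1 e2) (x + y).
Proof. by case=> ? <- [? <-]. Qed.

Lemma ev_B s e1 e2 x y : ev s e1 x -> ev s e2 y -> ev s (ESub e1 e2) (x - y).
Proof. by case=> ? <- [? <-]. Qed.

Lemma ev_Dn s e1 e2 x y : ev s e1 x%:Z -> ev s e2 y%:Z ->
  ev s (EAdd e1 e2) (x + y)%N%:Z.
Proof. by rewrite PoszD; exact: ev_D. Qed.

Lemma wp_conseq c s Q Q' : wp c s Q -> (forall t, Q t -> Q' t) -> wp c s Q'.
Proof. by case=> sc q QQ'; split=> //; exact: QQ'. Qed.

Lemma wp_frame c s Q : wp c s Q -> wp c s (fun t => Q t /\ frame (mods c) s t).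
Proof. by case=> sc q; split=> //; split=> // j; exact: den_frame. Qed.

Lemma wp_skip s Q : Q s -> wp ASkip s Q. Proof. by []. Qed.

Lemma wp_set j e1 e2 i z s Q : ev s e1 i%:Z -> ev s e2 z -> Q (upd s j i z) ->
  wp (ASet j e1 e2) s Q.
Proof. by move=> [s1 E1] [s2 E2] q; split=> /=; rewrite E1 // E2. Qed.

Lemma wp_seq c1 c2 s Q : wp c1 s (fun t => wp c2 t Q) -> wp (ASeq c1 c2) s Q.
Proof. by case=> s1 [s2 q]. Qed.

Lemma wp_if e z c1 c2 s Q : ev s e z -> (0 < z -> wp c1 s Q) ->
  (z <= 0 -> wp c2 s Q) -> wp (AIf e c1 c2) s Q.
Proof.
move=> [se E] h1 h2; rewrite /wp /= E.
by case: ltP => [/h1[]|/h2[]].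
Qed.

Lemma wp_for x y c s N (Inv : nat -> state -> Prop) :
    x \notin mods c -> y \notin x :: mods c -> s y 0%N = N%:Z -> (N <= B)%N ->
    Inv 0%N (upd s x 0 0) ->
    (forall i t, (i < N)%N -> frame (x :: mods c) s t -> t x 0%N = i%:Z ->
       Inv i t -> wp c t (fun t' => Inv i.+1 (upd t' x 0 i.+1%:Z))) ->
  wp (AFor x y c) s (Inv N).
Proof.
move=> xc yc sy NB I0 IS.
have st i : (i <= N)%N ->
    Inv i (iteri i (fun i t => upd (den inp c t) x 0 i.+1%:Z) (upd s x 0 0)) /\
    forall k, (k < i)%N ->
      safe inp F B c (iteri k (fun i t => upd (den inp c t) x 0 i.+1%:Z) (upd s x 0 0)).
  elim: i => [|i IH] iN; first by [].
  have [Ii si] := IH (ltnW iN).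
  have [||ic Ic] := IS i _ iN _ _ Ii.
  - by move=> j /iteri_frame ->.
  - exact: iteri_counter.
  split; first exact: Ic.
  by move=> k; rewrite ltnS leq_eqVlt => /orP[/eqP->|/si].
have [IN sN] := st N (leqnn N).
by split; rewrite /= sy.
Qed.

(* The pair [(fa, va)] of arrays is a partial map: position [j] is defined when
   [fa] is positive there. *)
Section Relax.

Variables (fa va : nat) (Rl : nat -> int -> Prop).

Definition ub s j z := 0 < s fa j /\ s va j <= z.

Definition leub s t := forall j z, ub s j z -> ub t j z.

Definition sound s := forall j, 0 < s fa j -> Rl j (s va j).

Lemma leub_trans s t u : leub s t -> leub t u -> leub s u.
Proof. by move=> st tu j z /st/tu. Qed.

Lemma ub_trans s j z z' : ub s j z -> z <= z' -> ub s j z'.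
Proof. by case=> ? /le_trans h /h. Qed.

Lemma leub_frame X s t : frame X s t -> fa \notin X -> va \notin X -> leub s t.
Proof. by move=> st fX vX j z; rewrite /ub !st. Qed.

Lemma sound_frame X s t : frame X s t -> fa \notin X -> va \notin X ->
  sound s -> sound t.
Proof. by move=> st fX vX so j; rewrite !st //; exact: so. Qed.

Definition relax (idx val : aexp) :=
  AIf (EA fa idx)
    (AIf (ESub (EA va idx) val) (ASet va idx val) ASkip)
    (ASeq (ASet va idx val) (ASet fa idx (EC 1))).

Lemma wp_relax idx val i z s : fa != va -> ev s idx i%:Z ->
    ev (upd s va i z) idx i%:Z -> ev s val z -> sound s -> Rl i z ->
  wp (relax idx val) s (fun t => [/\ leub s t, sound t & ub t i z]).
Proof.
move=> fv ei ei' ez so rz.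
have vf : (va == fa) = false by rewrite eq_sym; apply/negbTE.
apply: wp_if (ev_A ei erefl) _ _ => f0.
  apply: wp_if (ev_B (ev_A ei erefl) ez) _ _ => vz.
    apply: wp_set ei ez _; split.
    - move=> j z' [fj vj]; rewrite /ub /upd (negbTE fv) eqxx; split=> //.
      by case: eqP vj => [->|//] vj; lia.
    - move=> j; rewrite /upd (negbTE fv) eqxx => fj.
      by case: eqP => [->|_] //; exact: so.
    - by rewrite /ub /upd (negbTE fv) !eqxx.
  by apply: wp_skip; split=> //; split=> //; lia.
apply: wp_seq; apply: wp_set ei ez _; apply: wp_set ei' (ev_C _ _) _; split.
- move=> j z' [fj vj]; rewrite /ub /upd (negbTE fv) vf !eqxx.
  by case: eqP fj vj => [->|//] fj; rewrite ltNge f0 in fj.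
- move=> j; rewrite /upd (negbTE fv) vf !eqxx.
  by case: eqP => [->|_] //; exact: so.
- by rewrite /ub /upd (negbTE fv) vf !eqxx.
Qed.

Lemma wp_for_relax x y c s N (P K : nat -> state -> Prop) :
    x \notin mods c -> y \notin x :: mods c -> s y 0%N = N%:Z -> (N <= B)%N ->
    fa != x -> va != x -> sound s -> K 0%N (upd s x 0 0) ->
    (forall i t t', leub t t' -> P i t -> P i t') ->
    (forall i t, (i < N)%N -> frame (x :: mods c) s t -> t x 0%N = i%:Z ->
       leub s t -> sound t -> K i t -> (forall i', (i' < i)%N -> P i' t) ->
       wp c t (fun t' => [/\ leub t t', sound t', P i t' &
                             K i.+1 (upd t' x 0 i.+1%:Z)])) ->
  wp (AFor x y c) s
    (fun t => [/\ leub s t, sound t & forall i, (i < N)%N -> P i t]).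
Proof.
move=> xc yc sy NB fx vx so K0 Pm body.
have upd_frame t i : frame [:: x] t (upd t x 0 i).
  by move=> j; rewrite inE /upd => /negPf->.
have notx j : j != x -> j \notin [:: x] by rewrite inE.
have lx t i : leub t (upd t x 0 i) by apply: leub_frame (upd_frame t i) _ _; exact: notx.
have sx t i : sound t -> sound (upd t x 0 i).
  by apply: sound_frame (upd_frame t i) _ _; exact: notx.
apply: (wp_conseq (Q := fun t => [/\ leub s t, sound t, K N t &
                                  forall i, (i < N)%N -> P i t])); last by move=> t [].
apply: (wp_for (Inv := fun i t => [/\ leub s t, sound t, K i t &
                                  forall i', (i' < i)%N -> P i' t])) => //.
  by split=> //; exact: sx.
move=> i t iN fr tx [st sot Ki Pi].
apply: wp_conseq (body i t iN fr tx st sot Ki Pi) _ => t' [tt' sot' Pt' Kt'].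
split=> //.
- exact: leub_trans st (leub_trans tt' (lx _ _)).
- exact: sx.
- move=> i'; rewrite ltnS leq_eqVlt => /orP[/eqP->|i'i].
    exact: Pm (lx _ _) Pt'.
  by apply: Pm (Pi _ i'i); exact: leub_trans tt' (lx _ _).
Qed.

End Relax.

End Wp.

Arguments ev_C {inp F s} z.
Arguments ev_V {inp F s j z}.
Arguments wp_set {inp F B j e1 e2 i z s Q}.
Arguments wp_skip {inp F B s Q}.

(** * The algorithm *)

Local Notation vn := 0%N (only parsing).
Local Notation vk := 1%N (only parsing).
Local Notation vK := 2%N (only parsing).
Local Notation vL := 3%N (only parsing).
Local Notation vNN := 4%N (only parsing).
Local Notation vN2 := 5%N (only parsing).
Local Notation vs := 6%N (only parsing).
Local Notation vt := 7%N (only parsing).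
Local Notation vb := 8%N (only parsing).
Local Notation vx := 9%N (only parsing).
Local Notation vi := 10%N (only parsing).
Local Notation vr := 11%N (only parsing).
Local Notation vu := 12%N (only parsing).
Local Notation vv := 13%N (only parsing).
Local Notation vX := 14%N (only parsing).
Local Notation vy := 15%N (only parsing).
Local Notation vrem := 16%N (only parsing).
Local Notation vgoff := 17%N (only parsing).
Local Notation voff := 18%N (only parsing).
Local Notation vsrc := 19%N (only parsing).
Local Notation vacc := 20%N (only parsing).
Local Notation vans := 21%N (only parsing).
Local Notation aR := 22%N (only parsing).
Local Notation aP := 23%N (only parsing).
Local Notation aGF := 24%N (only parsing).
Local Notation aGW := 25%N (only parsing).
Local Notation aTK := 26%N (only parsing).
Local Notation aTF := 27%N (only parsing).
Local Notation aTV := 28%N (only parsing).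
Local Notation aDF := 29%N (only parsing).
Local Notation aDV := 30%N (only parsing).

Local Notation "x ::= e" := (ASet x (EC 0%:Z) e) (at level 65).
Local Notation "c1 ;; c2" := (ASeq c1 c2) (at level 67, right associativity).
Local Notation "e1 +e e2" := (EAdd e1 e2) (at level 50, left associativity).
Local Notation "e1 -e e2" := (ESub e1 e2) (at level 50, left associativity).

Definition cell (u v : nat) : aexp := EA aR (EV u) +e EV v.

Definition powers : acom :=
  vn ::= EI (EC 0%:Z) ;; vk ::= EI (EC 1%:Z) ;; vK ::= EC 1%:Z ;;
  AFor vx vk (ASet aP (EV vx) (EV vK) ;; vK ::= EV vK +e EV vK).

Definition row_offsets : acom :=
  vL ::= EV vn +e EV vK +e EV vK ;; vacc ::= EC 0%:Z ;;
  AFor vx vL (ASet aR (EV vx) (EV vacc) ;; vacc ::= EV vacc +e EV vn).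

Definition scalars : acom :=
  vNN ::= EA aR (EV vn) ;; vN2 ::= EV vNN +e EV vNN ;;
  vs ::= EI (EC 2%:Z) ;; vt ::= EI (EC 3%:Z) ;; vb ::= EI (EC 4%:Z).

(* Both graphs go to [aGF] (edge flags) and [aGW] (weights): the problem graph
   at offset 0, the movement graph at offset [n * n]. The loop at vertex 0 of
   the problem graph is dropped, since cells 5 and 6 are overwritten. *)
Definition load_graphs : acom :=
  ASet aGF (EC 0%:Z) (EC 0%:Z) ;;
  AFor vx vN2
    (AIf (EV vx)
       (ASet aGF (EV vx) (EI (EC 5%:Z +e (EV vx +e EV vx))) ;;
        ASet aGW (EV vx) (EI (EC 6%:Z +e (EV vx +e EV vx))))
       ASkip).

Definition load_tokens : acom :=
  AFor vi vk (ASet aTK (EV vi) (EI (EC 5%:Z +e (EV vN2 +e EV vN2) +e EV vi))).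

Definition zero_weights : acom := AFor vx vNN (ASet aGW (EV vx) (EC 0%:Z)).

Definition bellman_ford : acom :=
  relax aTF aTV (EV voff +e EV vsrc) (EC 0%:Z) ;;
  AFor vr vn (AFor vu vn (AFor vv vn
    (AIf (EA aGF (EV vgoff +e cell vu vv))
      (AIf (EA aTF (EV voff +e EV vu))
        (relax aTF aTV (EV voff +e EV vv)
           (EA aTV (EV voff +e EV vu) +e EA aGW (EV vgoff +e cell vu vv)))
        ASkip)
      ASkip))).

Definition distances : acom :=
  vgoff ::= EV vNN ;;
  AFor vi vk
    (voff ::= EA aR (EV vi) ;; vsrc ::= EA aTK (EV vi) ;; bellman_ford) ;;
  vgoff ::= EC 0%:Z ;; voff ::= EA aR (EV vk) ;; vsrc ::= EV vs ;; bellman_ford.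

Definition dp_init : acom :=
  AFor vi vk
    (AIf (EA aTF (cell vi vs))
       (relax aDF aDV (EA aR (EA aP (EV vi)) +e EV vs) (EA aTV (cell vi vs)))
       ASkip).

Definition dp_step : acom :=
  AIf (EA aGF (cell vu vv))
  (AIf (EA aTF (EV voff +e EV vu))
  (AIf (EA aTF (EV voff +e EV vv))
  (AIf (EA aTV (EV voff +e EV vu) +e EA aGW (cell vu vv)
        -e EA aTV (EV voff +e EV vv)) ASkip
  (AIf (EA aTF (cell vi vv))
  (AIf (EA aDF (cell vX vu))
     (relax aDF aDV (EA aR (EV vX +e EA aP (EV vi)) +e EV vv)
        (EA aDV (cell vX vu) +e EA aTV (cell vi vv)))
  ASkip) ASkip)) ASkip) ASkip) ASkip.

(* [vrem] is [X] modulo [2 ^ i.+1], for the successive bits [i] of [X]. *)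
Definition dp_bits : acom :=
  AFor vy vk
    (vi ::= EV vk -e EC 1%:Z -e EV vy ;;
     AIf (EA aP (EV vi) -e EV vrem)
       (AFor vu vn (AFor vv vn dp_step))
       (vrem ::= EV vrem -e EA aP (EV vi))).

Definition dp : acom :=
  AFor vr vk (AFor vX vK (vrem ::= EV vX ;; dp_bits)).

Definition search : acom :=
  AFor vX vK
    (AIf (EA aDF (cell vX vt))
       (AIf (EA aDV (cell vX vt) -e EV vb) ASkip (vans ::= EC 1)) ASkip).

Definition setup (zero : bool) : acom :=
  powers ;; row_offsets ;; scalars ;; load_graphs ;; load_tokens ;;
  (if zero then zero_weights else ASkip).

Definition discovery (zero : bool) : acom :=
  setup zero ;; distances ;; dp_init ;; dp ;; search.

Lemma wf_discovery zero : wf 31 (discovery zero).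
Proof. by case: zero. Qed.

Section Correctness.

Variables (n : nat) (G : wdigraph int n) (M : wdigraph nat n).
Variables (s t : 'I_n) (tk : seq 'I_n) (b : int) (zero : bool).
Variables (inp : nat -> int) (F B : nat).

Local Notation k := (size tk).

Hypothesis inp_n : inp 0 = n%:Z.
Hypothesis inp_k : inp 1 = k%:Z.
Hypothesis inp_s : inp 2 = (s : nat)%:Z.
Hypothesis inp_t : inp 3 = (t : nat)%:Z.
Hypothesis inp_b : inp 4 = b.
Hypothesis inp_G : forall u v : 'I_n,
  inp (5 + 2 * (u * n + v))%N = (edge G u v : nat)%:Z /\
  inp (6 + 2 * (u * n + v))%N = odflt 0 (G u v).
Hypothesis inp_M : forall u v : 'I_n,
  inp (5 + 2 * (n * n + (u * n + v)))%N = (edge M u v : nat)%:Z /\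
  inp (6 + 2 * (n * n + (u * n + v)))%N = odflt 0 (int_graph M u v).
Hypothesis inp_tk : forall i, (i < k)%N ->
  inp (5 + 4 * (n * n) + i)%N = (nth s tk i : nat)%:Z.
Hypothesis F_def : F = (5 + 4 * (n * n) + k)%N.
Hypothesis B_L : (n + 2 * 2 ^ k <= B)%N.
Hypothesis B_k : (k <= B)%N.
Hypothesis B_N2 : (2 * (n * n) <= B)%N.

Local Notation wp := (wp inp F B).
Local Notation ev := (ev inp F).
Implicit Types (st : state).

Let n_gt0 : (0 < n)%N. Proof. exact: leq_ltn_trans (leq0n s) (ltn_ord s). Qed.

Lemma wp_setV x e z st Q : ev st e z -> Q (upd st x 0 z) -> wp (x ::= e) st Q.
Proof. by apply: wp_set; exact: ev_C. Qed.

Lemma wp_read x a st Q : (a < 5)%N -> Q (upd st x 0 (inp a)) ->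
  wp (x ::= EI (EC a%:Z)) st Q.
Proof.
move=> a5; apply: wp_setV; apply: ev_I (ev_C _) _ _; first by rewrite F_def; lia.
by rewrite !inE; lia.
Qed.

Lemma wp_powers st : wp powers st (fun st' =>
  [/\ st' vn 0%N = n, st' vk 0%N = k, st' vK 0%N = (2 ^ k)%N &
      forall j, (j < k)%N -> st' aP j = (2 ^ j)%N]).
Proof.
apply: wp_seq; apply: wp_read => //.
apply: wp_seq; apply: wp_read => //.
apply: wp_seq; apply: (wp_setV (ev_C _)).
pose Inv i (st' : state) := [/\ st' vn 0%N = n, st' vk 0%N = k, st' vK 0%N = (2 ^ i)%N &
      forall j, (j < i)%N -> st' aP j = (2 ^ j)%N].
apply: (wp_for (Inv := Inv)) => //.
move=> i st' ik _ xi [n' k' K' P'].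
apply: wp_seq; apply: (wp_set (ev_V xi) (ev_V K')).
apply: (wp_setV (ev_Dn (ev_V K') (ev_V K'))).
split=> //; first by rewrite expnS mul2n -addnn.
move=> j; rewrite ltnS /upd /= => ji; case: eqP => [->//|] ?; apply: P'; lia.
Qed.

Lemma wp_row_offsets st : st vn 0%N = n -> st vK 0%N = (2 ^ k)%N ->
  wp row_offsets st (fun st' =>
    forall x, (x < n + 2 * 2 ^ k)%N -> st' aR x = (x * n)%N).
Proof.
move=> n' K'.
apply: wp_seq; apply: (wp_setV (ev_Dn (ev_Dn (ev_V n') (ev_V K')) (ev_V K'))).
apply: wp_seq; apply: (wp_setV (ev_C _)).
rewrite -addnA addnn -mul2n.
pose Inv i (st' : state) := st' vacc 0%N = (i * n)%N /\
  forall x, (x < i)%N -> st' aR x = (x * n)%N.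
apply: (wp_conseq (Q := Inv (n + 2 * 2 ^ k)%N)); last by move=> st' [].
apply: (wp_for (Inv := Inv)) => // i st' iL fr xi [acc R'].
have n'' : st' vn 0%N = n by rewrite fr.
apply: wp_seq; apply: (wp_set (ev_V xi) (ev_V acc)).
apply: (wp_setV (ev_Dn (ev_V acc) (ev_V n''))).
split=> //; first by rewrite mulSn addnC.
move=> j; rewrite ltnS /upd /= => ji; case: eqP => [->//|] ?; apply: R'; lia.
Qed.

Lemma wp_scalars st : st vn 0%N = n ->
    (forall x, (x < n + 2 * 2 ^ k)%N -> st aR x = (x * n)%N) ->
  wp scalars st (fun st' => [/\ st' vNN 0%N = (n * n)%N,
    st' vN2 0%N = (2 * (n * n))%N, st' vs 0%N = s, st' vt 0%N = t & st' vb 0%N = b]).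
Proof.
move=> n' R'.
have RN : st aR n = (n * n)%N by rewrite R' // -{1}[n]addn0 ltn_add2l muln_gt0 expn_gt0.
apply: wp_seq; apply: (wp_setV (ev_A (ev_V n') RN)).
apply: wp_seq; apply: (wp_setV (ev_Dn (ev_V _) (ev_V _))); [by []|by []|].
rewrite addnn -mul2n.
apply: wp_seq; apply: wp_read => //.
apply: wp_seq; apply: wp_read => //.
by apply: wp_read.
Qed.

Lemma wp_load_graphs st : st vN2 0%N = (2 * (n * n))%N ->
  wp load_graphs st (fun st' => st' aGF 0%N <= 0 /\ forall x, (0 < x < 2 * (n * n))%N ->
      st' aGF x = inp (5 + 2 * x)%N /\ st' aGW x = inp (6 + 2 * x)%N).
Proof.
move=> N2.
apply: wp_seq; apply: (wp_set (ev_C 0%:Z) (ev_C _)).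
pose Inv i (st' : state) := st' aGF 0%N <= 0 /\ forall x, (0 < x < i)%N ->
      st' aGF x = inp (5 + 2 * x)%N /\ st' aGW x = inp (6 + 2 * x)%N.
apply: (wp_for (Inv := Inv)) => // [|i st' iN _ xi [GF0 GF]].
  by split=> // x /andP[]; case: x.
have Vi : ev st' (EV vx) i%:Z := ev_V xi.
apply: (wp_if Vi) => i0; last first.
  apply: wp_skip; split=> // x xi1; apply: (GF x); lia.
apply: wp_seq; apply: (wp_set Vi (ev_I (ev_Dn (ev_C 5%:Z) (ev_Dn Vi Vi)) _ _)).
- by rewrite F_def; lia.
- by rewrite !inE; lia.
have Vi' z : ev (upd st' aGF i z) (EV vx) i%:Z by apply: ev_V.
apply: (wp_set (Vi' _) (ev_I (ev_Dn (ev_C 6%:Z) (ev_Dn (Vi' _) (Vi' _))) _ _)).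
- by rewrite F_def; lia.
- by rewrite !inE; lia.
rewrite addnn -mul2n; split.
  by rewrite /upd /=; case: eqP => // E; lia.
move=> x xi1; rewrite /upd /=; case: eqP => [->//|] ?; apply: (GF x); lia.
Qed.

Lemma wp_load_tokens st : st vk 0%N = k -> st vN2 0%N = (2 * (n * n))%N ->
  wp load_tokens st (fun st' =>
    forall i, (i < k)%N -> st' aTK i = (nth s tk i : nat)).
Proof.
move=> k' N2.
apply: (wp_for (Inv := fun i st' =>
  forall i', (i' < i)%N -> st' aTK i' = (nth s tk i' : nat))) => // i st' ik fr ii TK.
have N2' : st' vN2 0%N = (2 * (n * n))%N by rewrite fr.
have Vi : ev st' (EV vi) i%:Z := ev_V ii.
have VN : ev st' (EV vN2) (2 * (n * n))%N%:Z := ev_V N2'.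
apply: (wp_set Vi (ev_I (ev_Dn (ev_Dn (ev_C 5%:Z) (ev_Dn VN VN)) Vi) _ _)).
- by rewrite F_def; lia.
- by rewrite !inE; lia.
move=> i'; rewrite ltnS /upd /= => ii'; case: eqP => [->|ne]; last by apply: TK; lia.
by rewrite -inp_tk //; congr (inp _); lia.
Qed.

Lemma wp_zero_weights st : st vNN 0%N = (n * n)%N ->
  wp zero_weights st (fun st' =>
    (forall x, (x < n * n)%N -> st' aGW x = 0) /\
    (forall x, (n * n <= x)%N -> st' aGW x = st aGW x)).
Proof.
move=> NN.
apply: (wp_for (Inv := fun i st' =>
  (forall x, (x < i)%N -> st' aGW x = 0) /\
  (forall x, (n * n <= x)%N -> st' aGW x = st aGW x))) => //.
  by apply: leq_trans B_N2; rewrite leq_pmull.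
move=> i st' iN _ xi [lo hi].
apply: (wp_set (ev_V xi) (ev_C _)); split=> x; rewrite ?ltnS /upd /=.
  by move=> xi'; case: eqP => // ?; apply: lo; lia.
by move=> xN; case: eqP => [?|_]; [lia|exact: hi].
Qed.

Definition searched_graph : wdigraph int n := fun u v =>
  if (u * n + v == 0)%N then None
  else if zero then omap (fun=> 0) (G u v) else G u v.

Definition graph_at st (g : nat) (D : wdigraph int n) :=
  forall u v : 'I_n, if D u v is Some w
    then 0 < st aGF (g + (u * n + v))%N /\ st aGW (g + (u * n + v))%N = w
    else st aGF (g + (u * n + v))%N <= 0.

Record env st : Prop := Env {
  env_n : st vn 0%N = n; env_k : st vk 0%N = k; env_K : st vK 0%N = (2 ^ k)%N;
  env_NN : st vNN 0%N = (n * n)%N; env_s : st vs 0%N = s; env_t : st vt 0%N = t;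
  env_b : st vb 0%N = b;
  env_R : forall x, (x < n + 2 * 2 ^ k)%N -> st aR x = (x * n)%N;
  env_P : forall i, (i < k)%N -> st aP i = (2 ^ i)%N;
  env_TK : forall i, (i < k)%N -> st aTK i = (nth s tk i : nat);
  env_G : graph_at st 0 searched_graph;
  env_M : graph_at st (n * n) (int_graph M)
}.

Definition env_arrays : seq nat :=
  [:: vn; vk; vK; vNN; vs; vt; vb; aR; aP; aTK; aGF; aGW].

Lemma env_frame X st st' : all (fun j => j \notin X) env_arrays ->
  frame X st st' -> env st -> env st'.
Proof.
move=> /allP aX fr [e1 e2 e3 e4 e5 e6 e7 e8 e9 e10 eG eM].
have E j : j \in env_arrays -> st' j = st j by move=> /aX; exact: fr.
by split; rewrite ?E // => u v; rewrite !E //; [exact: eG|exact: eM].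
Qed.

Lemma wp_setup st : wp (setup zero) st env.
Proof.
apply: wp_seq; apply: (wp_conseq (wp_frame (wp_powers _))) => st1 [[n1 k1 K1 P1] _].
apply: wp_seq; apply: (wp_conseq (wp_frame (wp_row_offsets n1 K1))) => st2 [R2 fr2].
have n2 : st2 vn 0%N = n by rewrite fr2.
apply: wp_seq; apply: (wp_conseq (wp_frame (wp_scalars n2 R2))).
move=> st3 [[NN3 N3 s3 t3 b3] fr3].
apply: wp_seq; apply: (wp_conseq (wp_frame (wp_load_graphs N3))) => st4 [[G04 G4] fr4].
have k4 : st4 vk 0%N = k by rewrite fr4 // fr3 // fr2.
have N4 : st4 vN2 0%N = (2 * (n * n))%N by rewrite fr4.
apply: wp_seq; apply: (wp_conseq (wp_frame (wp_load_tokens k4 N4))) => st5 [TK5 fr5].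
have uvn (u v : 'I_n) : (u * n + v < n * n)%N.
  have := ltn_ord u; have := ltn_ord v; nia.
have M5 : graph_at st5 (n * n) (int_graph M).
  move=> u v; have := uvn u v => uv.
  have [|h1 h2] := G4 (n * n + (u * n + v))%N; first by lia.
  rewrite !fr5 // h1 h2; have [-> ->] := inp_M u v.
  by rewrite /edge /int_graph; case: (M u v).
have G5 (u v : 'I_n) : (u * n + v != 0)%N ->
    st5 aGF (u * n + v)%N = (edge G u v : nat) /\ st5 aGW (u * n + v)%N = odflt 0 (G u v).
  move=> uv0; have := uvn u v => uv.
  have [|h1 h2] := G4 (u * n + v)%N; first by lia.
  by rewrite !fr5 // h1 h2; exact: inp_G.
have env5 st6 : frame [:: vx; aGW] st5 st6 -> graph_at st6 0 searched_graph ->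
    graph_at st6 (n * n) (int_graph M) -> env st6.
  move=> fr6 *; split=> //.
  - by rewrite fr6 // fr5 // fr4 // fr3.
  - by rewrite fr6 // fr5.
  - by rewrite fr6 // fr5 // fr4 // fr3 // fr2.
  - by rewrite fr6 // fr5 // fr4.
  - by rewrite fr6 // fr5 // fr4.
  - by rewrite fr6 // fr5 // fr4.
  - by rewrite fr6 // fr5 // fr4.
  - by move=> x xL; rewrite fr6 // fr5 // fr4 // fr3 // R2.
  - by move=> i ik; rewrite fr6 // fr5 // fr4 // fr3 // fr2 // P1.
  - by move=> i ik; rewrite fr6 // TK5.
rewrite /searched_graph in env5 *; case: zero env5 => env5.
  have NN5 : st5 vNN 0%N = (n * n)%N by rewrite fr5 // fr4.
  apply: (wp_conseq (wp_frame (wp_zero_weights NN5))) => st6 [[lo hi] fr6].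
  apply: env5 => // u v; last first.
    by have := M5 u v; rewrite (fr6 aGF) // !hi // leq_addr.
  rewrite add0n; case: eqP => [->|/eqP/G5[GF GW]]; first by rewrite fr6 // fr5.
  rewrite fr6 // lo //; move: GF; rewrite /edge; case: (G u v) => [w|] /= ->;
    by rewrite ?lo.
apply: wp_skip; apply: env5 => // u v.
rewrite add0n; case: eqP => [->|/eqP/G5[GF GW]]; first by rewrite fr5.
by rewrite GF GW /edge; case: (G u v).
Qed.

Lemma ev_cell st u v (x y : nat) : env st -> (x < n + 2 * 2 ^ k)%N ->
  st u 0%N = x -> st v 0%N = y -> ev st (cell u v) (x * n + y)%N%:Z.
Proof.
by move=> en xL ux vy; apply: ev_Dn (ev_V vy); apply: ev_A (ev_V ux) _; exact: env_R.
Qed.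

Lemma row_inj (x y x' y' : nat) : (y < n)%N -> (y' < n)%N ->
  (x * n + y = x' * n + y')%N -> x = x' /\ y = y'.
Proof.
move=> yn yn' E; have yy : y = y'.
  by have := congr1 (modn^~ n) E; rewrite !modnMDl !modn_small.
split=> //; apply/eqP; rewrite -(eqn_pmul2r n_gt0); apply/eqP.
by move: E; rewrite yy => /addIn.
Qed.

(* Row [i < k] of the distance table belongs to the [i]-th token in the movement
   graph, row [k] to the source in the problem graph. *)
Definition row_graph (i : nat) : wdigraph int n :=
  if (i < k)%N then int_graph M else searched_graph.

Local Notation row_source i := (nth s tk i).

Definition walk_at (j : nat) (c : int) : Prop :=
  exists i (v : 'I_n) r,
    [/\ (i <= k)%N, j = (i * n + v)%N & wk (row_graph i) (row_source i) r v c].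

Lemma walk_atP i (v : 'I_n) c : walk_at (i * n + v) c ->
  exists r, wk (row_graph i) (row_source i) r v c.
Proof.
case=> i' [v' [r [_ E W]]]; exists r.
by have [-> /val_inj->] := row_inj (ltn_ord v) (ltn_ord v') E.
Qed.

Local Notation ubT := (ub aTF aTV).
Local Notation leT := (leub aTF aTV).
Local Notation soundT := (sound aTF aTV walk_at).

Definition bf_ctx i g st := [/\ env st, st vgoff 0%N = Posz g,
  st voff 0%N = (i * n)%N, st vsrc 0%N = (row_source i : nat)
  & graph_at st g (row_graph i)].

Lemma bf_ctx_frame X st st' i g :
    all (fun j => j \notin X) [:: vgoff, voff, vsrc & env_arrays] ->
  frame X st st' -> bf_ctx i g st -> bf_ctx i g st'.
Proof.
move=> aX fr [en g' o' s' gr].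
have E j : j \in [:: vgoff, voff, vsrc & env_arrays] -> st' j = st j.
  by move=> jX; apply: fr; exact: (allP aX).
split; rewrite ?E //; last by move=> u v; rewrite !E //; exact: gr.
by apply: env_frame fr en; case/and4P: aX.
Qed.

Lemma ltn_rows x : (x < n)%N -> (x < n + 2 * 2 ^ k)%N.
Proof. by move=> xn; rewrite ltn_addr. Qed.

Lemma n_leB : (n <= B)%N.
Proof. by apply: leq_trans B_L; rewrite leq_addr. Qed.

Lemma wp_bellman_ford st i g : (i <= k)%N -> bf_ctx i g st -> soundT st ->
  wp bellman_ford st (fun st' => [/\ leT st st', soundT st' &
    forall r (v : 'I_n) c, (r <= n)%N -> wk (row_graph i) (row_source i) r v c ->
      ubT st' (i * n + v) c]).
Proof.
move=> ik cx so; apply: wp_seq.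
have [_ _ o' s' _] := cx.
have src0 : wp (relax aTF aTV (EV voff +e EV vsrc) (EC 0)) st
    (fun st' => [/\ leT st st', soundT st' & ubT st' (i * n + row_source i) 0]).
  apply: wp_relax => //.
  - by apply: ev_Dn; apply: ev_V.
  - by apply: ev_Dn; apply: ev_V.
  - by exists i, (row_source i), 0%N; split=> //; constructor.
apply: (wp_conseq (wp_frame src0)) => st1 [[le1 so1 ub1] fr1].
have cx1 : bf_ctx i g st1 by apply: bf_ctx_frame fr1 cx.
have [en1 _ _ _ _] := cx1.
pose P j st' := forall (v : 'I_n) c, wk (row_graph i) (row_source i) j.+1 v c ->
  ubT st' (i * n + v) c.
apply: (wp_conseq (Q := fun st' => [/\ leT st1 st', soundT st' &
    forall j, (j < n)%N -> P j st'])).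
  apply: (wp_for_relax (K := fun _ _ => True)) => //.
  - exact: env_n en1.
  - exact: n_leB.
  - by move=> j st' st'' le' h v c W; exact/le'/h.
  move=> j st2 jn fr2 _ le2 so2 _ Pj.
  have cx2 : bf_ctx i g st2 by apply: bf_ctx_frame fr2 cx1.
  have [en2 _ _ _ _] := cx2.
  have ub2 (v : 'I_n) c : wk (row_graph i) (row_source i) j v c -> ubT st2 (i * n + v) c.
    case: j Pj {jn fr2} => [|j] Pj W; last exact: Pj W.
    by inversion W; apply: le2.
  pose Pv (u v : nat) st' := forall (u' v' : 'I_n) w c, u' = u :> nat -> v' = v :> nat ->
    row_graph i u' v' = Some w -> ubT st2 (i * n + u') c -> ubT st' (i * n + v') (c + w).
  have Pv_mono u v st' st'' : leT st' st'' -> Pv u v st' -> Pv u v st''.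
    by move=> le' h u' v' w c eu ev' E h'; apply: le'; exact: (h u').
  apply: (wp_conseq (Q := fun st' => [/\ leT st2 st', soundT st' &
      forall u, (u < n)%N -> forall v, (v < n)%N -> Pv u v st'])).
    apply: (wp_for_relax (P := fun u st' => forall v, (v < n)%N -> Pv u v st')
      (K := fun _ _ => True)) => //.
    - exact: env_n en2.
    - exact: n_leB.
    - by move=> u st' st'' le' h v vn; apply: Pv_mono le' _; exact: h.
    move=> u st3 un fr3 u3 le3 so3 _ _.
    have cx3 : bf_ctx i g st3 by apply: bf_ctx_frame fr3 cx2.
    have [en3 _ _ _ _] := cx3.
    apply: (wp_conseq (Q := fun st' => [/\ leT st3 st', soundT st' &
      forall v, (v < n)%N -> Pv u v st'])); last by move=> st' [].
    apply: (wp_for_relax (K := fun _ _ => True)) => //.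
    - exact: env_n en3.
    - exact: n_leB.
    - by move=> v; exact: Pv_mono.
    move=> v st4 vn fr4 v4 le4 so4 _ _.
    have cx4 : bf_ctx i g st4 by apply: bf_ctx_frame fr4 cx3.
    have u4 : st4 vu 0%N = u by rewrite fr4.
    have [en4 g4 o4 _ gr4] := cx4.
    have evc : ev st4 (EV vgoff +e cell vu vv) (g + (u * n + v))%N%:Z.
      by apply: ev_Dn (ev_V g4) _; apply: ev_cell => //; exact: ltn_rows.
    have evu : ev st4 (EV voff +e EV vu) (i * n + u)%N%:Z.
      exact: ev_Dn (ev_V o4) (ev_V u4).
    have := gr4 (Ordinal un) (Ordinal vn) => /=.
    case E: (row_graph i (Ordinal un) (Ordinal vn)) => [w|] gr.
      have [gr1 gr2] := gr.
      apply: (wp_if (ev_A evc erefl)) => [_|]; last by rewrite leNgt gr1.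
      apply: (wp_if (ev_A evu erefl)) => fu; last first.
        apply: wp_skip; split=> // u' v' w' c eu _ _ h.
        by have [] := le4 _ _ (le3 _ _ h); rewrite eu ltNge fu.
      have rl : walk_at (i * n + v) (st4 aTV (i * n + u)%N + w).
        have [r W] := walk_atP (v := Ordinal un) (so4 _ fu).
        by exists i, (Ordinal vn), r.+1; split=> //; apply: wk_rcons E.
      have rlx : wp (relax aTF aTV (EV voff +e EV vv)
           (EA aTV (EV voff +e EV vu) +e EA aGW (EV vgoff +e cell vu vv))) st4
         (fun st' => [/\ leT st4 st', soundT st' &
           ubT st' (i * n + v) (st4 aTV (i * n + u)%N + w)]).
        apply: wp_relax => //.
        - exact: ev_Dn (ev_V o4) (ev_V v4).
        - by apply: ev_Dn; apply: ev_V.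
        - apply: ev_D; first exact: ev_A evu erefl.
          by rewrite -gr2; exact: ev_A evc erefl.
      apply: (wp_conseq rlx) => st5 [le5 so5 ub5]; split=> //.
      move=> u' v' w' c eu ev' E' h.
      have uu : u' = Ordinal un by apply: val_inj.
      have vv' : v' = Ordinal vn by apply: val_inj.
      move: E'; rewrite uu vv' E => -[<-]; apply: ub_trans ub5 _.
      have [_] := le4 _ _ (le3 _ _ h); rewrite uu /=.
      by rewrite lerD2r.
    apply: (wp_if (ev_A evc erefl)) => [|_]; first by rewrite ltNge gr.
    apply: wp_skip; split=> // u' v' w' c eu ev' E' h.
    have uu : u' = Ordinal un by apply: val_inj.
    have vv' : v' = Ordinal vn by apply: val_inj.
    by move: E'; rewrite uu vv' E.
  move=> st3 [le3 so3 P3]; split=> // v c W.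
  inversion W as [|r0 u c0 v0 w W0 E]; subst.
  by apply: (P3 u _ v _ u v w c0) => //; exact: ub2.
move=> st' [le' so' P']; split=> //; first exact: leub_trans le1 le'.
case=> [|r] v c rn W; last exact: P' W.
by inversion W; subst; apply: le'.
Qed.

Definition table_full st (i : nat) := forall r (v : 'I_n) c, (r <= n)%N ->
  wk (row_graph i) (row_source i) r v c -> ubT st (i * n + v) c.

Lemma wp_distances st : env st -> soundT st -> wp distances st (fun st' =>
  [/\ soundT st', forall i, (i <= k)%N -> table_full st' i &
      st' voff 0%N = (k * n)%N]).
Proof.
move=> en so.
have kL : (k < n + 2 * 2 ^ k)%N.
  by apply: leq_trans (leq_addl _ _); rewrite mul2n -addnn ltn_addr // ltn_expl.
apply: wp_seq; apply: (wp_setV (ev_V (env_NN en))).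
set st1 := upd _ _ _ _.
have en1 : env st1 by apply: (@env_frame [:: vgoff]) en => // j; rewrite inE /st1 /upd => /negPf->.
have g1 : st1 vgoff 0%N = (n * n)%N by [].
have so1 : soundT st1 by [].
have full_mono i st' st'' : leT st' st'' -> table_full st' i -> table_full st'' i.
  by move=> le' full r v c rn W; apply: le'; exact: full rn W.
apply: wp_seq; apply: (wp_conseq (wp_frame (Q := fun st' => [/\ leT st1 st', soundT st' &
    forall i, (i < k)%N -> table_full st' i]) _)).
  apply: (wp_for_relax (K := fun _ _ => True)) => //; first exact: env_k en1.
  move=> i st2 ik fr2 i2 _ so2 _ _.
  have en2 : env st2 by apply: env_frame fr2 en1.
  apply: wp_seq; apply: (wp_setV (ev_A (ev_V i2) _)).
    by apply: env_R en2 _ _; apply: ltn_trans kL.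
  set st3 := upd _ _ _ _.
  apply: wp_seq; apply: (wp_setV (ev_A (ev_V (i2 : st3 vi 0%N = i)) (env_TK en2 ik : st3 aTK i = _))).
  set st4 := upd _ _ _ _.
  have fr4 : frame [:: voff; vsrc] st2 st4.
    by move=> j; rewrite !inE negb_or /st4 /st3 /upd => /andP[/negPf-> /negPf->].
  have cx4 : bf_ctx i (n * n) st4.
    split=> //; first exact: env_frame fr4 en2.
      by rewrite fr4 // fr2.
    by rewrite /row_graph ik; have := env_M (env_frame (X := [:: voff; vsrc]) isT fr4 en2).
  apply: (wp_conseq (wp_bellman_ford (ltnW ik) cx4 _)) => // st5 [le5 so5 full5].
  by split=> //.
move=> st2 [[_ so2 full2] fr2].
have en2 : env st2 by apply: env_frame fr2 en1.
apply: wp_seq; apply: (wp_setV (ev_C 0%:Z)); set st3 := upd _ _ _ _.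
apply: wp_seq; apply: (wp_setV (ev_A (ev_V (env_k en2 : st3 vk 0%N = k)) (env_R en2 kL : st3 aR k = _))).
set st4 := upd _ _ _ _.
apply: wp_seq; apply: (wp_setV (ev_V (env_s en2 : st4 vs 0%N = s))).
set st5 := upd _ _ _ _.
have fr5 : frame [:: vgoff; voff; vsrc] st2 st5.
  move=> j; rewrite !inE !negb_or /st5 /st4 /st3 /upd.
  by move=> /and3P[/negPf-> /negPf-> /negPf->].
have en5 : env st5 by apply: env_frame fr5 en2.
have cx5 : bf_ctx k 0 st5.
  by split=> //; [rewrite nth_default|rewrite /row_graph ltnn; exact: env_G en5].
apply: (wp_conseq (wp_frame (wp_bellman_ford (leqnn k) cx5 _))) => // st6 [[le6 so6 full6] fr6].
split=> //; last by rewrite fr6.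
move=> i; rewrite leq_eqVlt => /orP[/eqP->//|ik].
by apply: full_mono (full2 i ik); apply: le6.
Qed.

Hypothesis no_neg : no_negative_cycle G.

Lemma path_searched u q : path (edge searched_graph) u q ->
  path (edge G) u q /\
  weight searched_graph (u :: q) = if zero then 0 else weight G (u :: q).
Proof.
elim: q u => [|v q IH] u /=; first by rewrite !weight1 if_same.
rewrite !weight_cons => /andP[uv /IH[-> ->]].
move: uv; rewrite /edge /searched_graph; case: eqP => // _.
by case: zero; case: (G u v).
Qed.

Lemma no_neg_searched : no_negative_cycle searched_graph.
Proof.
by move=> x p up /path_searched[pG ->]; case: zero => //; exact: no_neg up pG.
Qed.

Lemma int_graph_wk_ge0 (u v : 'I_n) r c : wk (int_graph M) u r v c -> 0 <= c.
Proof.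
elim=> [//|{}r {}v {}c v' w _ c0]; rewrite /int_graph.
by case: (M v v') => [w'|] //= [<-]; rewrite addr_ge0.
Qed.

Lemma no_neg_int_graph : no_negative_cycle (int_graph M).
Proof. by move=> x p _ /path_wk/int_graph_wk_ge0. Qed.

Lemma table_full_ub st i r (v : 'I_n) c : table_full st i ->
  wk (row_graph i) (row_source i) r v c -> ubT st (i * n + v) c.
Proof.
have nn : no_negative_cycle (row_graph i).
  by rewrite /row_graph; case: ifP => _; [exact: no_neg_int_graph|exact: no_neg_searched].
move=> full /(wk_short nn)[r' [c' [r'n c'c W]]].
exact: ub_trans (full _ _ _ r'n W) c'c.
Qed.

Definition dist_of st (v : 'I_n) : option int :=
  if 0 < st aTF (k * n + v)%N then Some (st aTV (k * n + v)%N) else None.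

Section Tables.

Variable st0 : state.
Hypothesis sound0 : soundT st0.
Hypothesis full0 : forall i, (i <= k)%N -> table_full st0 i.

Lemma dist_of_wk v d : dist_of st0 v = Some d -> exists r, wk searched_graph s r v d.
Proof.
rewrite /dist_of; case: ifP => // f [<-].
by have [r] := walk_atP (sound0 f); rewrite /row_graph ltnn nth_default //; exists r.
Qed.

Lemma dist_of_min v r c : wk searched_graph s r v c ->
  exists2 d, dist_of st0 v = Some d & d <= c.
Proof.
move=> W; have := @table_full_ub st0 k r v c (full0 (leqnn k)).
rewrite /row_graph ltnn nth_default // => /(_ W)[f le].
by rewrite /dist_of f; eexists.
Qed.

Local Notation tgt := (tight searched_graph (dist_of st0)).
Local Notation obt := (ob M s s tgt tk).

Record dp_ctx st : Prop := DpCtx {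
  dp_env : env st;
  dp_off : st voff 0%N = (k * n)%N;
  dp_TF : st aTF = st0 aTF;
  dp_TV : st aTV = st0 aTV
}.

Lemma dp_ctx_frame X st st' :
    all (fun j => j \notin X) [:: voff, aTF, aTV & env_arrays] ->
  frame X st st' -> dp_ctx st -> dp_ctx st'.
Proof.
move=> /and4P[h1 h2 h3 h4] fr [en o f w]; split; rewrite ?fr //.
exact: env_frame fr en.
Qed.

Lemma token_wk i (v : 'I_n) : (i < k)%N -> 0 < st0 aTF (i * n + v)%N ->
  exists r, wk (int_graph M) (row_source i) r v (st0 aTV (i * n + v)%N).
Proof. by move=> ik f; have := walk_atP (sound0 f); rewrite /row_graph ik. Qed.

Lemma token_ub i (v : 'I_n) r c : (i < k)%N ->
  wk (int_graph M) (row_source i) r v c -> ubT st0 (i * n + v) c.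
Proof.
by move=> ik W; apply: (@table_full_ub _ _ r); [exact: full0 (ltnW ik)|rewrite /row_graph ik].
Qed.

Definition ob_at (j : nat) (c : int) : Prop :=
  exists js (v : 'I_n), j = (token_mask js * n + v)%N /\ obt js v c.

Lemma ob_atP X (v : 'I_n) c : ob_at (X * n + v) c -> exists2 js, X = token_mask js & obt js v c.
Proof.
case=> js [v' [E O]]; exists js.
  by have [] := row_inj (ltn_ord v) (ltn_ord v') E.
by have [_ /val_inj->] := row_inj (ltn_ord v) (ltn_ord v') E.
Qed.

Local Notation ubD := (ub aDF aDV).
Local Notation leD := (leub aDF aDV).
Local Notation soundD := (sound aDF aDV ob_at).

Lemma pow_rows i : (i < k)%N -> (2 ^ i < n + 2 * 2 ^ k)%N.
Proof.
move=> ik; apply: leq_trans (leq_addl _ _).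
have : (2 ^ i <= 2 ^ k)%N by rewrite leq_exp2l // ltnW.
have : (0 < 2 ^ k)%N by rewrite expn_gt0.
lia.
Qed.

Lemma k_rows i : (i < k)%N -> (i < n + 2 * 2 ^ k)%N.
Proof. by move=> /pow_rows; apply: leq_ltn_trans; rewrite ltnW // ltn_expl. Qed.

Lemma wp_dp_init st : dp_ctx st -> soundD st -> wp dp_init st (fun st' =>
  [/\ soundD st' & forall i r c, (i < k)%N ->
     wk (int_graph M) (row_source i) r s c -> ubD st' (2 ^ i * n + s) c]).
Proof.
move=> cx so.
pose P i st' := forall r c,
  wk (int_graph M) (row_source i) r s c -> ubD st' (2 ^ i * n + s) c.
apply: (wp_conseq (Q := fun st' => [/\ leD st st', soundD st' &
    forall i, (i < k)%N -> P i st'])); last first.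
  by move=> st' [_ so' P']; split=> // i r c ik; exact: P'.
apply: (wp_for_relax (K := fun _ _ => True)) => //; first exact: env_k (dp_env cx).
  by move=> i st' st'' le' h r c W; apply/le'/(h r).
move=> i st1 ik fr1 i1 le1 so1 _ _.
have cx1 : dp_ctx st1 by apply: dp_ctx_frame fr1 cx.
have [en1 _ TF1 TV1] := cx1.
have evc : ev st1 (cell vi vs) (i * n + s)%N%:Z.
  by apply: ev_cell => //; [exact: k_rows | exact: env_s en1].
apply: (wp_if (ev_A evc erefl)) => f; rewrite TF1 in f; last first.
  apply: wp_skip; split=> // r c W.
  by have [] := token_ub ik W; rewrite ltNge f.
have [r0 W0] := token_wk ik f.
have P1 := env_P en1 ik.
have idx st' z : st' = st1 \/ st' = upd st1 aDV (2 ^ i * n + s) z ->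
    ev st' (EA aR (EA aP (EV vi)) +e EV vs) (2 ^ i * n + s)%N%:Z.
  move=> h; have fr : frame [:: aDV] st1 st'.
    by case: h => -> // j; rewrite inE /upd => /negPf->.
  apply: ev_Dn; last by apply: ev_V; rewrite fr //; exact: env_s en1.
  apply: (@ev_A _ _ _ _ _ (2 ^ i)%N); last by rewrite fr // (env_R en1) ?pow_rows.
  by apply: (@ev_A _ _ _ _ _ i); [apply: ev_V|]; rewrite fr.
have rlx : wp (relax aDF aDV (EA aR (EA aP (EV vi)) +e EV vs) (EA aTV (cell vi vs))) st1
   (fun st' => [/\ leD st1 st', soundD st' &
     ubD st' (2 ^ i * n + s) (st0 aTV (i * n + s)%N)]).
  apply: wp_relax => //.
  - by apply: (idx _ 0); left.
  - by apply: idx; right.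
  - by apply: ev_A evc _; rewrite TV1.
  - exists [:: i], s; split; first by rewrite /token_mask big_seq1.
    exact: ob_source W0.
apply: (wp_conseq rlx) => st2 [le2 so2 ub2]; split=> // r c W.
by have [_ le3] := token_ub ik W; apply: ub_trans ub2 le3.
Qed.

Definition relaxed st st' X i (u v : nat) := forall (u' v' : 'I_n) c r c',
  u' = u :> nat -> v' = v :> nat -> (X %% 2 ^ i.+1 < 2 ^ i)%N -> tgt u' v' ->
  wk (int_graph M) (row_source i) r v' c' -> ubD st (X * n + u') c ->
  ubD st' ((X + 2 ^ i) * n + v') (c + c').

Lemma relaxed_mono st st' st'' X i u v :
  leD st' st'' -> relaxed st st' X i u v -> relaxed st st'' X i u v.
Proof. by move=> le' h u' v' c r c' eu ev' X' e W o; apply: le'; exact: h W o. Qed.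

Lemma wp_dp_step st X i u v : dp_ctx st -> soundD st ->
    (X < 2 ^ k)%N -> (i < k)%N -> (u < n)%N -> (v < n)%N ->
    (X %% 2 ^ i.+1 < 2 ^ i)%N ->
    st vX 0%N = X -> st vi 0%N = i -> st vu 0%N = u -> st vv 0%N = v ->
  wp dp_step st (fun st' => [/\ leD st st', soundD st' & relaxed st st' X i u v]).
Proof.
move=> cx so XK ik un vn bit X1 i1 u1 v1.
have [en o1 TF TV] := cx.
pose U := Ordinal un; pose V := Ordinal vn.
have XL : (X < n + 2 * 2 ^ k)%N by apply: ltn_addl; rewrite mul2n -addnn ltn_addr.
have skip : ~ (tgt U V /\ ubT st0 (i * n + v) (st0 aTV (i * n + v)%N) /\
    0 < st aDF (X * n + u)%N) ->
    wp ASkip st (fun st' => [/\ leD st st', soundD st' & relaxed st st' X i u v]).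
  move=> no; apply: wp_skip; split=> // u' v' c r c' eu ev' _ e W o; case: no.
  have [eu' ev''] : u' = U /\ v' = V by split; apply: val_inj.
  move: e W o; rewrite eu' ev'' => e W [o _]; split=> //; split=> //.
  by have [f _] := token_ub ik W; split.
have ec1 : ev st (cell vu vv) (u * n + v)%N%:Z by apply: ev_cell => //; exact: ltn_rows.
have eu1 : ev st (EV voff +e EV vu) (k * n + u)%N%:Z by apply: ev_Dn; apply: ev_V.
have ev1 : ev st (EV voff +e EV vv) (k * n + v)%N%:Z by apply: ev_Dn; apply: ev_V.
have ei1 : ev st (cell vi vv) (i * n + v)%N%:Z by apply: ev_cell => //; exact: k_rows.
have eX1 : ev st (cell vX vu) (X * n + u)%N%:Z by apply: ev_cell.
have := env_G en U V; rewrite add0n /= => gr.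
apply: (wp_if (ev_A ec1 erefl)) => f1; last first.
  apply: skip => -[tg _]; move: tg gr; rewrite /tight.
  by case: (searched_graph U V) => // w _ [gr _]; rewrite ltNge f1 in gr.
have [w E Ew] : exists2 w, searched_graph U V = Some w & st aGW (u * n + v)%N = w.
  move: gr; case: (searched_graph U V) => [w [_ gr]|]; first by exists w.
  by rewrite leNgt f1.
apply: (wp_if (ev_A eu1 erefl)) => f2; rewrite TF in f2; last first.
  by apply: skip => -[tg _]; move: tg; rewrite /tight E /dist_of ltNge f2.
apply: (wp_if (ev_A ev1 erefl)) => f3; rewrite TF in f3; last first.
  apply: skip => -[tg _]; move: tg; rewrite /tight E.
  by case: (dist_of _ U) => // d; rewrite /dist_of ltNge f3.
have tgE : tgt U V = (st0 aTV (k * n + u)%N + w - st0 aTV (k * n + v)%N <= 0).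
  by rewrite /tight E /dist_of f2 f3 subr_le0.
have et1 := ev_B (ev_D (ev_A eu1 (congr1 (@^~ _) TV)) (ev_A ec1 Ew))
                 (ev_A ev1 (congr1 (@^~ _) TV)).
apply: (wp_if et1) => f4.
  by apply: skip => -[tg _]; move: tg; rewrite tgE leNgt f4.
apply: (wp_if (ev_A ei1 erefl)) => f5; rewrite TF in f5; last first.
  by apply: skip => -[_ [[f _] _]]; rewrite ltNge f5 in f.
apply: (wp_if (ev_A eX1 erefl)) => f6; last first.
  by apply: skip => -[_ [_ f]]; rewrite ltNge f6 in f.
have [r0 W0] := token_wk (v := V) ik f5.
have [js Xjs O] := ob_atP (v := U) (so _ f6).
have [ujs _] := ob_uniq O.
have ijs : i \notin js by rewrite -token_mask_bit // -Xjs -ltnNge.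
have P1 := env_P en ik.
have XiL : (X + 2 ^ i < n + 2 * 2 ^ k)%N.
  have : (2 ^ i <= 2 ^ k)%N by rewrite leq_exp2l // ltnW.
  by lia.
have idx st' : frame [:: aDV] st st' ->
    ev st' (EA aR (EV vX +e EA aP (EV vi)) +e EV vv) ((X + 2 ^ i) * n + v)%N%:Z.
  move=> fr; apply: ev_Dn; last by apply: ev_V; rewrite fr.
  apply: (@ev_A _ _ _ _ _ (X + 2 ^ i)%N); last by rewrite fr // (env_R en).
  apply: ev_Dn; first by apply: ev_V; rewrite fr.
  by apply: (@ev_A _ _ _ _ _ i); [apply: ev_V|]; rewrite fr.
have rlx : wp (relax aDF aDV (EA aR (EV vX +e EA aP (EV vi)) +e EV vv)
        (EA aDV (cell vX vu) +e EA aTV (cell vi vv))) st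
   (fun st' => [/\ leD st st', soundD st' & ubD st' ((X + 2 ^ i) * n + v)
      (st aDV (X * n + u)%N + st0 aTV (i * n + v)%N)]).
  apply: wp_relax => //.
  - exact: idx.
  - by apply: idx => j; rewrite inE /upd => /negPf->.
  - by apply: ev_D; [exact: ev_A eX1 erefl | apply: ev_A ei1 _; rewrite TV].
  - exists (i :: js), V; split.
      by rewrite Xjs /token_mask big_cons [(2 ^ i + _)%N]addnC.
    by apply: ob_step O ik ijs _ W0; rewrite tgE.
apply: (wp_conseq rlx) => st1 [le1 so1 ub1]; split=> //.
move=> u' v' c r c' eu ev' _ e W o.
have [eu' ev''] : u' = U /\ v' = V by split; apply: val_inj.
move: W o; rewrite eu' ev'' => W [_ o]; apply: ub_trans ub1 _.
by have [_ le3] := token_ub ik W; apply: lerD.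
Qed.

Lemma modn_high_bit X i : (X %% 2 ^ i.+1 < 2 ^ i)%N -> (X %% 2 ^ i.+1 = X %% 2 ^ i)%N.
Proof.
move=> lt; rewrite -[RHS](@modn_dvdm (2 ^ i.+1)) ?dvdn_exp2l //.
exact/esym/modn_small.
Qed.

Lemma modn_low_bit X i : (2 ^ i <= X %% 2 ^ i.+1)%N ->
  (X %% 2 ^ i.+1 - 2 ^ i = X %% 2 ^ i)%N.
Proof.
move=> le; rewrite -[RHS](@modn_dvdm (2 ^ i.+1)) ?dvdn_exp2l //.
have : (X %% 2 ^ i.+1 < 2 ^ i.+1)%N by rewrite ltn_mod expn_gt0.
move: (X %% 2 ^ i.+1)%N le => x le; rewrite expnS => lt.
by rewrite -{2}(subnK le) modnDr modn_small //; lia.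
Qed.

Lemma wp_dp_bits st X : dp_ctx st -> soundD st -> (X < 2 ^ k)%N ->
    st vX 0%N = X -> st vrem 0%N = X ->
  wp dp_bits st (fun st' => [/\ leD st st', soundD st' &
    forall i u v, (i < k)%N -> (u < n)%N -> (v < n)%N -> relaxed st st' X i u v]).
Proof.
move=> cx so XK X1 rem1.
pose P y st' := forall u v, (u < n)%N -> (v < n)%N -> relaxed st st' X (k - y.+1) u v.
pose K y (st' : state) := st' vrem 0%N = (X %% 2 ^ (k - y))%N.
apply: (wp_conseq (Q := fun st' => [/\ leD st st', soundD st' &
    forall y, (y < k)%N -> P y st'])); last first.
  move=> st' [le' so' P']; split=> // i u v ik.
  have := P' (k - i.+1)%N ltac:(lia) u v.
  by rewrite (_ : (k - (k - i.+1).+1)%N = i) //; lia.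
apply: (wp_for_relax (K := K)) => //.
- exact: env_k (dp_env cx).
- by rewrite /K subn0 modn_small.
- by move=> y st' st'' le' h u v un vn; apply: relaxed_mono le' _; exact: h.
move=> y st1 yk fr1 y1 le1 so1 K1 _; set i := (k - y.+1)%N.
have ik : (i < k)%N by rewrite /i; lia.
have cx1 : dp_ctx st1 by apply: dp_ctx_frame fr1 cx.
have X1' : st1 vX 0%N = X by rewrite fr1.
have ei : ev st1 (EV vk -e EC 1%:Z -e EV vy) i.
  rewrite (_ : i%:Z = k%:Z - 1%:Z - y%:Z); last by rewrite /i; lia.
  by apply: ev_B (ev_V y1); apply: ev_B (ev_C _); apply: ev_V; exact: env_k (dp_env cx1).
apply: wp_seq; apply: (wp_setV ei); set st2 := upd _ _ _ _.
have fr2 : frame [:: vi] st1 st2 by move=> j; rewrite inE /st2 /upd => /negPf->.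
have cx2 : dp_ctx st2 by apply: dp_ctx_frame fr2 cx1.
have [en2 _ _ _] := cx2.
have i2 : st2 vi 0%N = i by [].
have K2 : st2 vrem 0%N = (X %% 2 ^ i.+1)%N.
  by rewrite fr2 // K1; congr (X %% 2 ^ _)%N%:Z; rewrite /i; lia.
have le12 : leD st1 st2 by [].
have so2 : soundD st2 by [].
have eP : ev st2 (EA aP (EV vi)) (2 ^ i)%N by apply: ev_A (ev_V i2) _; exact: env_P.
apply: (wp_if (ev_B eP (ev_V K2))) => bit; last first.
  have bit' : (2 ^ i <= X %% 2 ^ i.+1)%N by lia.
  apply: (wp_setV (ev_B (ev_V K2) eP)); split=> //.
    by move=> u v _ _ u' v' c r c' _ _; rewrite ltnNge bit'.
  by rewrite /K /upd /= -/i -(modn_low_bit bit') -subzn.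
have {}bit : (X %% 2 ^ i.+1 < 2 ^ i)%N by lia.
have X2 : st2 vX 0%N = X by [].
pose Pu u st' := forall v, (v < n)%N -> relaxed st2 st' X i u v.
apply: (wp_conseq (wp_frame (Q := fun st' => [/\ leD st2 st', soundD st' &
    forall u, (u < n)%N -> Pu u st']) _)); last first.
  move=> st3 [[le3 so3 P3] fr3]; split=> //.
    move=> u v un vn u' v' c r c' eu ev' X' e W o.
    exact: (P3 u un v vn) W (le1 _ _ o).
  by rewrite /K /upd /= fr3 // K2 -/i (modn_high_bit bit).
apply: (wp_for_relax (K := fun _ _ => True)) => //.
- exact: env_n en2.
- exact: n_leB.
- by move=> u st' st'' le' h v vn; apply: relaxed_mono le' _; exact: h.
move=> u st3 un fr3 u3 le3 so3 _ _.
have cx3 : dp_ctx st3 by apply: dp_ctx_frame fr3 cx2.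
apply: (wp_conseq (Q := fun st' => [/\ leD st3 st', soundD st' &
    forall v, (v < n)%N -> relaxed st2 st' X i u v])); last by move=> st' [].
apply: (wp_for_relax (K := fun _ _ => True)) => //.
- exact: env_n (dp_env cx3).
- exact: n_leB.
- by move=> v st' st'' le' h; exact: relaxed_mono le' h.
move=> v st4 vn fr4 v4 le4 so4 _ _.
have cx4 : dp_ctx st4 by apply: dp_ctx_frame fr4 cx3.
have X4 : st4 vX 0%N = X by rewrite fr4 // fr3.
have i4 : st4 vi 0%N = i by rewrite fr4 // fr3.
have u4 : st4 vu 0%N = u by rewrite fr4.
apply: (wp_conseq (wp_dp_step cx4 so4 XK ik un vn bit X4 i4 u4 v4)).
move=> st5 [le5 so5 P5]; split=> // u' v' c r c' eu ev' X' e W o.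
exact: P5 W (le4 _ _ (le3 _ _ o)).
Qed.

Lemma wp_dp st : dp_ctx st -> soundD st ->
    (forall i r c, (i < k)%N ->
       wk (int_graph M) (row_source i) r s c -> ubD st (2 ^ i * n + s) c) ->
  wp dp st (fun st' => soundD st' /\ forall js (v : 'I_n) c,
    obt js v c -> ubD st' (token_mask js * n + v) c).
Proof.
move=> cx so init.
pose P r st' := forall js (v : 'I_n) c, size js = r.+2 -> obt js v c ->
  ubD st' (token_mask js * n + v) c.
have init' js (v : 'I_n) c : size js = 1%N -> obt js v c ->
    ubD st (token_mask js * n + v) c.
  move=> sz O; case: O sz => [i r {}c ik W _|js' u {}c i v' r c' O _ _ _ _ [sz]].
    by rewrite /token_mask big_seq1; exact: init W.
  by case: O sz.
apply: (wp_conseq (Q := fun st' => [/\ leD st st', soundD st' &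
    forall r, (r < k)%N -> P r st'])); last first.
  move=> st' [le' so' P']; split=> // js v c O.
  have [ujs /allP js_lt] := ob_uniq O.
  have : (size js <= k)%N.
    rewrite -[k](size_iota 0); apply: uniq_leq_size => // j /js_lt.
    by rewrite mem_iota.
  case E: (size js) => [|[|r]] rk; last by apply: (P' r) => //; exact: ltnW.
    by case: O E.
  by apply/le'/init'.
apply: (wp_for_relax (K := fun _ _ => True)) => //; first exact: env_k (dp_env cx).
  by move=> r st' st'' le' h js v c sz O; apply/le'/h.
move=> r st1 rk fr1 r1 le1 so1 _ Pr.
have cx1 : dp_ctx st1 by apply: dp_ctx_frame fr1 cx.
have ub1 js (v : 'I_n) c : size js = r.+1 -> obt js v c -> ubD st1 (token_mask js * n + v) c.
  case: r Pr {rk fr1 r1} => [|r] Pr sz O; first exact/le1/init'.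
  exact: (Pr r (ltnSn r)) sz O.
pose PX X st' := forall i u v, (i < k)%N -> (u < n)%N -> (v < n)%N ->
  relaxed st1 st' X i u v.
apply: (wp_conseq (Q := fun st' => [/\ leD st1 st', soundD st' &
    forall X, (X < 2 ^ k)%N -> PX X st'])); last first.
  move=> st' [le' so' P']; split=> // js v c sz O.
  case: O sz => [//|js' u {}c i v' r0 c' O ik ijs e W [sz]].
  have [ujs js_lt] := ob_uniq O.
  rewrite /token_mask big_cons [(2 ^ i + _)%N]addnC.
  apply: (P' _ (token_mask_lt ujs js_lt) i u v' ik (ltn_ord u) (ltn_ord v')
            u v' c r0 c' erefl erefl _ e W (ub1 _ _ _ sz O)).
  by rewrite ltnNge token_mask_bit.
apply: (wp_for_relax (K := fun _ _ => True)) => //.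
- exact: env_K (dp_env cx1).
- by apply: leq_trans B_L; lia.
- by move=> X st' st'' le' h i u v ik un vn; apply: relaxed_mono le' _; exact: h.
move=> X st2 XK fr2 X2 le2 so2 _ _.
have cx2 : dp_ctx st2 by apply: dp_ctx_frame fr2 cx1.
apply: wp_seq; apply: (wp_setV (ev_V X2)); set st3 := upd _ _ _ _.
have fr3 : frame [:: vrem] st2 st3 by move=> j; rewrite inE /st3 /upd => /negPf->.
have cx3 : dp_ctx st3 by apply: dp_ctx_frame fr3 cx2.
apply: (wp_conseq (wp_dp_bits cx3 _ XK _ _)) => // st4 [le4 so4 P4]; split=> //.
move=> i u v ik un vn u' v' c r' c' eu ev' X' e W o.
exact: (P4 i u v ik un vn) W (le2 _ _ o).
Qed.

Lemma wp_search st : dp_ctx st -> soundD st -> st vans 0%N = 0 ->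
    (forall js (v : 'I_n) c, obt js v c -> ubD st (token_mask js * n + v) c) ->
  wp search st (fun st' =>
    (st' vans 0%N = 1 /\ exists js c, obt js t c /\ c <= b) \/
    (st' vans 0%N = 0 /\ ~ exists js c, obt js t c /\ c <= b)).
Proof.
move=> cx so ans full.
pose Inv X (st' : state) :=
  (st' vans 0%N = 1 /\ exists js c, obt js t c /\ c <= b) \/
  (st' vans 0%N = 0 /\ forall X', (X' < X)%N -> ~ ubD st (X' * n + t) b).
apply: (wp_conseq (Q := Inv (2 ^ k)%N)).
  apply: (wp_for (Inv := Inv)) => //.
  - exact: env_K (dp_env cx).
  - by apply: leq_trans B_L; lia.
  - by right.
  move=> X st1 XK fr1 X1 I1.
  have cx1 : dp_ctx st1 by apply: dp_ctx_frame fr1 cx.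
  have [en1 _ _ _] := cx1.
  have eX : ev st1 (cell vX vt) (X * n + t)%N%:Z.
    by apply: ev_cell => //; [lia|exact: env_t].
  have DF1 : st1 aDF = st aDF by apply: fr1.
  have DV1 : st1 aDV = st aDV by apply: fr1.
  have skip : ~ ubD st (X * n + t) b -> wp ASkip st1 (fun t' => Inv X.+1 (upd t' vX 0 X.+1%:Z)).
    move=> no; apply: wp_skip; case: I1 => [[? ?]|[? no']]; [by left|right].
    split=> // X'; rewrite ltnS leq_eqVlt => /orP[/eqP->//|]; exact: no'.
  apply: (wp_if (ev_A eX erefl)) => f; rewrite DF1 in f; last first.
    by apply: skip => -[]; rewrite ltNge f.
  apply: (wp_if (ev_B (ev_A eX erefl) (ev_V (env_b en1)))) => g; rewrite DV1 in g.
    by apply: skip => -[_]; lia.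
  apply: (wp_setV (ev_C 1%:Z)); left; split=> //.
  have [js _ O] := ob_atP (so _ f).
  by exists js; eexists; split; [exact: O|lia].
move=> st' [[? ?]|[? no]]; [by left|right; split=> //].
move=> [js [c [O cb]]]; apply: (no (token_mask js)); last exact: ub_trans (full _ _ _ O) cb.
by have [u l] := ob_uniq O; apply: token_mask_lt.
Qed.

End Tables.

Definition discoverable : Prop := exists (T : {mset 'I_n}%mset) (p : seq 'I_n),
  [/\ reachable M (seq_mset tk) b T, shortest_st_path searched_graph s t p &
      {subset p <= T}].

Lemma wp_discovery : wp (discovery zero) (fun _ _ => 0) (fun st =>
  (st vans 0%N = 1 /\ discoverable) \/ (st vans 0%N = 0 /\ ~ discoverable)).
Proof.
apply: wp_seq; apply: (wp_conseq (wp_frame (wp_setup _))) => st1 [en1 fr1].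
have fr1' j : j \in [:: aTF; aDF; vans] -> st1 j = fun=> 0.
  by move=> jX; rewrite fr1 //; case: (zero); move: j jX; apply/allP.
apply: wp_seq; apply: (wp_conseq (wp_frame (wp_distances en1 _))).
  by move=> j; rewrite fr1'.
move=> st2 [[so2 full2 o2] fr2].
have en2 : env st2 by apply: env_frame fr2 en1.
have cx2 : dp_ctx st2 st2 by [].
have soD2 : sound aDF aDV (ob_at st2) st2 by move=> j; rewrite fr2 // fr1'.
apply: wp_seq; apply: (wp_conseq (wp_frame (wp_dp_init so2 full2 cx2 soD2))).
move=> st3 [[soD3 init3] fr3].
have cx3 : dp_ctx st2 st3 by apply: dp_ctx_frame fr3 cx2.
apply: wp_seq; apply: (wp_conseq (wp_frame (wp_dp so2 full2 cx3 soD3 init3))).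
move=> st4 [[soD4 full4] fr4].
have cx4 : dp_ctx st2 st4 by apply: dp_ctx_frame fr4 cx3.
have ans4 : st4 vans 0%N = 0 by rewrite fr4 // fr3 // fr2 // fr1'.
have D : discoverable <->
    exists js c, ob M s s (tight searched_graph (dist_of st2)) tk js t c /\ c <= b.
  have tP := shortest_tightP no_neg_searched (dist_of_wk so2) (dist_of_min full2).
  rewrite ob_reachableP; split=> [[T [p [rT /tP[q [-> pq lq uq]] sT]]]|].
    by exists T, q.
  move=> [T [q [rT pq lq uq sT]]]; exists T, (s :: q); split=> //.
  by apply/tP; exists q.
apply: (wp_conseq (wp_search cx4 soD4 ans4 full4)) => st5.
by rewrite D.
Qed.

End Correctness.

(** * Running time *)

Lemma size_bitsize s : (size s <= bitsize s)%N.
Proof. by rewrite -sum1_size /bitsize leq_sum. Qed.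

Lemma mbound_load s : mbound (load s) (bitsize s).
Proof.
move=> i; rewrite /load; case: (ltnP i (size s)) => si; last first.
  by rewrite nth_default.
apply: leq_trans (ltnW (bitlen_gt _)) _; rewrite leq_exp2l // /bitsize.
by rewrite (big_rem _ (mem_nth 0 si)) /= leq_addr.
Qed.

Lemma computable_exp a q : computable (fun k => a * q ^ k)%N.
Proof.
pose step := Seq (Write (Cst 1%:Z) (mulexpr q (Get (Cst 1%:Z))))
                 (Write (Cst 0%:Z) (Minus (Get (Cst 0%:Z)) (Cst 1%:Z))).
exists (Seq (Write (Cst 1%:Z) (Cst a%:Z))
         (Seq (While (Get (Cst 0%:Z)) step) (Write (Cst 0%:Z) (Get (Cst 1%:Z))))) => k.
have loop j x m : m 0%N = j%:Z -> m 1%N = x%:Z ->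
    exists c m', exec (While (Get (Cst 0%:Z)) step) m c m' /\ m' 1%N = (x * q ^ j)%N%:Z.
  elim: j x m => [|j IH] x m m0 m1.
    do 2 eexists; split; last by rewrite expn0 muln1; exact: m1.
    by apply: exec_while_false; rewrite /= m0.
  set m2 := update (update m 1 (q%:Z * x%:Z)) 0 j%:Z.
  have [c st] : exists c, exec step m c m2.
    eexists; apply: exec_seq; first exact: exec_write.
    rewrite eval_mulexpr /= m1.
    rewrite /m2 (_ : j%:Z = eval (update m 1 (q%:Z * x%:Z)) (Minus (Get (Cst 0%:Z)) (Cst 1%:Z))).
      exact: exec_write.
    by rewrite /= /update /= m0 intS addrAC subrr add0r.
  have [||c' [m' [W E]]] := IH (q * x)%N m2; rewrite /m2 /update //=.
  do 2 eexists; split; first by apply: exec_while_true st W; rewrite /= m0.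
  by rewrite E expnS [(q * x)%N]mulnC mulnA.
have [||c [m [W E]]] := loop k a (update (load [:: k%:Z]) 1 a%:Z) => //.
do 2 eexists; split.
  apply: exec_seq; first exact: exec_write.
  by apply: exec_seq; [exact: W|exact: exec_write].
by rewrite /update /= E.
Qed.

Lemma FPT_uexec (P : param_problem) p a e :
    (forall x : pinstance P, 0 < bitsize (encode x))%N ->
    (forall x : pinstance P, exists t m,
      [/\ uexec p (load (encode x)) t m, yes x -> m 0%N = 1, ~ yes x -> m 0%N = 0 &
          (t <= a * (2 ^ parameter x * bitsize (encode x)).+1 ^ e.+1)%N]) ->
  FPT P.
Proof.
move=> N_gt0 run; set S := psize p.
pose A := (a * (1 + S * (2 + S * a + S)))%N; pose d := (e.+1 * 2)%N.
exists p, (fun k => A * 2 ^ d * (2 ^ d) ^ k)%N, d; split; first exact: computable_exp.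
move=> x; have [t [m [ex y1 y0 tle]]] := run x.
have [_ [c ec cle]] := uexec_exec ex (leqnn _) (mbound_load _).
exists c, m; split=> //; apply: leq_trans cle _.
move: (parameter x) (bitsize _) (N_gt0 x) tle => k N N0 tle.
rewrite -/S; set X := (2 ^ k * N).+1 in tle; set Y := (X ^ e.+1)%N in tle.
have X0 : (0 < X)%N by [].
have Y0 : (0 < Y)%N by rewrite expn_gt0.
have XY : (X <= Y)%N by rewrite -[X in (X <= _)%N]expn1 leq_pexp2l.
have NX : (N <= X)%N by rewrite /X ltnW // ltnS leq_pmull // expn_gt0.
apply: (@leq_trans (A * Y ^ 2)%N).
  rewrite /A.
  have h1 : (S * (N + S * t + S).+1 <= S * (2 + S * a + S) * Y)%N.
    rewrite -mulnA leq_mul2l; apply/orP; right.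
    have h2 : (S * t <= S * (a * Y))%N by rewrite leq_mul2l tle orbT.
    have h3 : (S <= S * Y)%N by rewrite leq_pmulr.
    rewrite !mulnDl -mulnA; lia.
  have h4 : (1 + S * (N + S * t + S).+1 <= (1 + S * (2 + S * a + S)) * Y)%N.
    by rewrite mulnDl mul1n leq_add.
  apply: leq_trans (leq_mul tle h4) _.
  by rewrite -mulnn; rewrite mulnACA.
move: A => A; rewrite -2!(mulnA A) leq_mul2l; apply/orP; right.
have -> : (2 ^ d * (2 ^ d) ^ k * N ^ d = (2 * (2 ^ k * N)) ^ d)%N.
  by rewrite (expnMn 2) (expnMn (2 ^ k)) mulnA -(expnM 2 d) -(expnM 2 k) (mulnC d).
rewrite /Y -expnM -/d leq_exp2r ?muln_gt0 //.
rewrite /X.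
have : (0 < 2 ^ k * N)%N by rewrite muln_gt0 expn_gt0.
lia.
Qed.

(** * The input *)

Lemma nth_flatten_const (T : Type) (x0 : T) (ss : seq (seq T)) m i j :
    all (fun r => size r == m) ss -> (j < m)%N ->
  nth x0 (flatten ss) (i * m + j) = nth x0 (nth [::] ss i) j.
Proof.
move=> sz jm; elim: ss i sz => [|r ss IH] i /=; first by rewrite !nth_nil.
case/andP=> /eqP rm sz; rewrite nth_cat rm; case: i => [|i] /=.
  by rewrite mul0n add0n jm.
rewrite -IH // ifN; last by rewrite -leqNgt mulSn -addnA leq_addr.
by rewrite mulSn -addnA addKn.
Qed.

Lemma size_flatten_const (T : Type) (ss : seq (seq T)) m :
  all (fun r => size r == m) ss -> size (flatten ss) = (size ss * m)%N.
Proof.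
by elim: ss => //= r ss IH /andP[/eqP rm /IH E]; rewrite size_cat rm E mulSn.
Qed.

Section Encoding.

Variables (W : Type) (toZ : W -> int) (n : nat) (D : wdigraph W n).

Let entry (u v : 'I_n) : seq int := if D u v is Some w then [:: 1; toZ w] else [:: 0; 0].

Let rows := [seq [seq entry u v | v <- enum 'I_n] | u <- enum 'I_n].

Let size_rows : all (fun r => size r == n) rows.
Proof. by apply/allP => _ /mapP[u _ ->]; rewrite size_map size_enum_ord. Qed.

Let size_entries : all (fun r => size r == 2) (flatten rows).
Proof.
apply/allP => r /flattenP[_ /mapP[u _ ->]] /mapP[v _ ->].
by rewrite /entry; case: (D u v).
Qed.

Lemma size_encode_graph : size (encode_graph toZ D) = (2 * (n * n))%N.
Proof.
rewrite /encode_graph -/rows (size_flatten_const size_entries).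
by rewrite (size_flatten_const size_rows) size_map size_enum_ord mulnC.
Qed.

Lemma nth_encode_graph (u v : 'I_n) :
  nth 0 (encode_graph toZ D) (2 * (u * n + v)) = (edge D u v : nat)%:Z /\
  nth 0 (encode_graph toZ D) (2 * (u * n + v)).+1 = odflt 0 (omap toZ (D u v)).
Proof.
have E j : (j < 2)%N ->
    nth 0 (encode_graph toZ D) (2 * (u * n + v) + j) = nth 0 (entry u v) j.
  move=> j2; rewrite [(2 * _)%N]mulnC /encode_graph -/rows.
  rewrite (nth_flatten_const _ _ size_entries j2).
  rewrite (nth_flatten_const _ _ size_rows) //.
  rewrite (nth_map u) ?size_enum_ord // (nth_map v) ?size_enum_ord //.
  by rewrite !nth_ord_enum.
have := E 0%N isT; have := E 1%N isT; rewrite addn0 addn1 => -> ->.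
by rewrite /entry /edge; case: (D u v).
Qed.

End Encoding.

Section Instance.

Variable I : instance.

Local Notation n := (num_vertices I).
Local Notation k := (num_tokens I).
Local Notation inp := (load (encode_instance I)).

Let n_gt0 : (0 < n)%N. Proof. exact: leq_ltn_trans (leq0n _) (ltn_ord (source I)). Qed.

Lemma size_encode_instance : size (encode_instance I) = (5 + 4 * (n * n) + k)%N.
Proof.
rewrite /encode_instance !size_cat !size_encode_graph size_map /= /num_tokens.
by rewrite [(4 * _)%N](mulnDl 2 2) !addnA.
Qed.

Lemma input_problem_graph (u v : 'I_n) :
  inp (5 + 2 * (u * n + v))%N = (edge (problem_graph I) u v : nat)%:Z /\
  inp (6 + 2 * (u * n + v))%N = odflt 0 (problem_graph I u v).
Proof.
have := ltn_ord u; have := ltn_ord v => vn un.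
have uv : (u * n + v < n * n)%N by nia.
have [E1 E2] := nth_encode_graph id (problem_graph I) u v.
rewrite /load /encode_instance !addSn !add0n /= !nth_cat !size_encode_graph E1 E2.
have -> : (2 * (u * n + v) < 2 * (n * n))%N by lia.
have -> : ((2 * (u * n + v)).+1 < 2 * (n * n))%N by lia.
by rewrite omap_id.
Qed.

Lemma input_movement_graph (u v : 'I_n) :
  inp (5 + 2 * (n * n + (u * n + v)))%N = (edge (movement_graph I) u v : nat)%:Z /\
  inp (6 + 2 * (n * n + (u * n + v)))%N = odflt 0 (int_graph (movement_graph I) u v).
Proof.
have := ltn_ord u; have := ltn_ord v => vn un.
have uv : (u * n + v < n * n)%N by nia.
have [E1 E2] := nth_encode_graph Posz (movement_graph I) u v.
rewrite /load /encode_instance !addSn !add0n /= !nth_cat !size_encode_graph.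
rewrite ![(2 * (n * n + _))%N]mulnDr.
have -> : (2 * (n * n) + 2 * (u * n + v) < 2 * (n * n))%N = false by lia.
have -> : ((2 * (n * n) + 2 * (u * n + v)).+1 < 2 * (n * n))%N = false by lia.
rewrite -addnS !addKn.
have -> : (2 * (u * n + v) < 2 * (n * n))%N by lia.
have -> : ((2 * (u * n + v)).+1 < 2 * (n * n))%N by lia.
by rewrite E1 E2.
Qed.

Lemma input_tokens i : (i < k)%N ->
  inp (5 + 4 * (n * n) + i)%N = (nth (source I) (tokens I) i : nat)%:Z.
Proof.
move=> ik; rewrite /load /encode_instance !addSn !add0n /= !nth_cat !size_encode_graph.
rewrite (_ : (4 * (n * n) + i)%N = (2 * (n * n) + (2 * (n * n) + i))%N); last by lia.
rewrite ifF ?addKn; last by lia.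
rewrite ifF ?addKn; last by lia.
by rewrite (nth_map (source I)).
Qed.

Lemma path_searched_uniq (zero : bool) u (q : seq 'I_n) : uniq (u :: q) ->
  path (edge (problem_graph I)) u q ->
  path (edge (searched_graph (problem_graph I) zero)) u q.
Proof.
elim: q u => //= v q IH u /and3P[uvq vq uq] /andP[uv pq].
rewrite IH ?vq // andbT; move: uv; rewrite /edge /searched_graph.
case: eqP => [uv0|_]; last by case: (zero); case: (problem_graph I u v).
move: uvq; rewrite inE negb_or -val_eqE /=.
have -> : u = 0%N :> nat by nia.
by have -> : v = 0%N :> nat by nia.
Qed.

Lemma st_path_searched (zero : bool) s t p :
  st_path (searched_graph (problem_graph I) zero) s t p <->
  st_path (problem_graph I) s t p.
Proof.
split=> -[q [-> pq lq uq]]; exists q; split=> //.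
  by have [] := path_searched pq.
exact: path_searched_uniq.
Qed.

Lemma weight_searched (zero : bool) s t p :
  st_path (searched_graph (problem_graph I) zero) s t p ->
  weight (searched_graph (problem_graph I) zero) p =
  if zero then 0 else weight (problem_graph I) p.
Proof. by case=> q [-> pq _ _]; have [] := path_searched pq. Qed.

Lemma shortest_zero s t p :
  shortest_st_path (searched_graph (problem_graph I) true) s t p <->
  st_path (problem_graph I) s t p.
Proof.
rewrite -(st_path_searched true); split=> [[]//|sp]; split=> // p' sp'.
by rewrite (weight_searched sp) (weight_searched sp').
Qed.

Lemma shortest_nonzero s t p :
  shortest_st_path (searched_graph (problem_graph I) false) s t p <->
  shortest_st_path (problem_graph I) s t p.
Proof.
split=> -[sp pmin]; split; try exact/(st_path_searched false).
  move=> p' /(st_path_searched false) sp'; have := pmin _ sp'.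
  by rewrite (weight_searched sp) (weight_searched sp').
have sp' := (st_path_searched false s t p).2 sp.
move=> p' sp''; rewrite (weight_searched sp') (weight_searched sp'').
exact/pmin/(st_path_searched false).
Qed.

(* Cells 5 and 6, the entry of the loop at vertex 0, serve as counter and
   accumulator for [n * n]; the other input cells are kept. *)
Definition prelude : program :=
  Seq (Write (Cst 5%:Z) (Get (Cst 0%:Z)))
  (Seq (Write (Cst 6%:Z) (Cst 0%:Z))
  (Seq (While (Get (Cst 5%:Z))
         (Seq (Write (Cst 6%:Z) (Plus (Get (Cst 6%:Z)) (Get (Cst 0%:Z))))
              (Write (Cst 5%:Z) (Minus (Get (Cst 5%:Z)) (Cst 1%:Z)))))
       (Write (Cst 6%:Z) (Plus (Cst 5%:Z)
         (Plus (mulexpr 4 (Get (Cst 6%:Z))) (Get (Cst 1%:Z))))))).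

Lemma prelude_rep F : F = (5 + 4 * (n * n) + k)%N ->
  exists t m, [/\ uexec prelude inp t m, rep 31 inp F m (fun _ _ => 0) &
                  (t <= 4 + 3 * n)%N].
Proof.
move=> F_def.
set body := (Seq (Write (Cst 6%:Z) (Plus (Get (Cst 6%:Z)) (Get (Cst 0%:Z))))
              (Write (Cst 5%:Z) (Minus (Get (Cst 5%:Z)) (Cst 1%:Z)))).
have loop j m x : m 0%N = n%:Z -> m 5%N = j%:Z -> m 6%N = x%:Z ->
    exists t m', [/\ uexec (While (Get (Cst 5%:Z)) body) m t m',
      m' 6%N = (x + j * n)%N%:Z, {in [predC [:: 5; 6]%N], m' =1 m} &
      (t <= 1 + 3 * j)%N].
  elim: j m x => [|j IH] m x m0 m5 m6.
    exists 1%N, m; split=> //; last by rewrite addn0.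
    by apply: uexec_while_false; rewrite /= m5.
  pose m1 := update m 6 (m 6%N + m 0%N).
  pose m2 := update m1 5 (m1 5%N - 1).
  have [|||t [m' [W E6 E t_le]]] := IH m2 (x + n)%N.
  - by [].
  - by rewrite /m2 /m1 /update /= m5 intS addrAC subrr add0r.
  - by rewrite /m2 /m1 /update /= m6 m0.
  exists (1 + (1 + 1) + t)%N, m'; split.
  - apply: uexec_while_true W; first by rewrite /= m5.
    by apply: uexec_seq; exact: uexec_write.
  - by rewrite E6 mulSn addnA.
  - move=> a a56; rewrite E //; move: a56; rewrite !inE negb_or => /andP[a5 a6].
    by rewrite /m2 /m1 /update (negbTE a5) (negbTE a6).
  - by rewrite mulnS; lia.
pose m0 := update (update inp 5 n%:Z) 6 0.
have [//||//|t [m [W E6 E t_le]]] := loop n m0 0%N; first by [].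
exists (1 + (1 + (t + 1)))%N, (update m 6 F%:Z); split; last by lia.
  apply: uexec_seq; first exact: uexec_write.
  apply: uexec_seq; first exact: uexec_write.
  apply: uexec_seq; first exact: W.
  rewrite (_ : F%:Z = eval m (Plus (Cst 5%:Z)
         (Plus (mulexpr 4 (Get (Cst 6%:Z))) (Get (Cst 1%:Z))))); first exact: uexec_write.
  have m1 : m 1%N = k by rewrite E.
  by rewrite /= m1 E6 F_def; lia.
have out a : a \notin [:: 5; 6]%N -> update m 6 F%:Z a = inp a.
  move=> a56; rewrite /update; move: (a56); rewrite !inE negb_or => /andP[a5 a6].
  by rewrite (negbTE a6) E // /m0 /update (negbTE a5) (negbTE a6).
split=> // [j i _|a _]; last exact: out.
rewrite out; last by rewrite !inE F_def; lia.
by rewrite /load nth_default // size_encode_instance F_def; lia.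
Qed.

Lemma loop_bounds N : (5 + 4 * (n * n) + k <= N)%N ->
  [/\ n + 2 * 2 ^ k <= 2 ^ k * N, k <= 2 ^ k * N, 2 * (n * n) <= 2 ^ k * N &
      n <= 2 ^ k * N]%N.
Proof.
have K0 : (0 < 2 ^ k)%N by rewrite expn_gt0.
move: (2 ^ k)%N K0 => K K0 N_big.
have nn : (n <= n * n)%N by rewrite leq_pmulr.
have NK : (N <= K * N)%N by rewrite leq_pmull.
split; try lia.
have : (K * (n + 2) <= K * N)%N by rewrite leq_mul2l; apply/orP; right; lia.
have : (n <= K * n)%N by rewrite leq_pmull.
lia.
Qed.

Definition discovery_program (zero : bool) : program :=
  Seq prelude (Seq (compile 31 (discovery zero)) (Write (Cst 0) (cexp 31 (EV vans)))).

Lemma discovery_programP (zero : bool) : exists t m,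
  [/\ uexec (discovery_program zero) inp t m,
      (m 0%N = 1 /\ discoverable (problem_graph I) (movement_graph I) (source I)
        (target I) (tokens I) (budget I) zero) \/
      (m 0%N = 0 /\ ~ discoverable (problem_graph I) (movement_graph I) (source I)
        (target I) (tokens I) (budget I) zero) &
      (t <= (9 + csize (discovery zero)) *
        (2 ^ k * bitsize (encode_instance I)).+1 ^ (csize (discovery zero)).+1)%N].
Proof.
set F := (5 + 4 * (n * n) + k)%N; set B := (2 ^ k * _)%N.
have [] := @loop_bounds (bitsize (encode_instance I)).
  by rewrite -size_encode_instance size_bitsize.
rewrite -/B => B_L B_k B_N2 B_n.
have [sd Qd] := @wp_discovery n (problem_graph I) (movement_graph I) (source I)
  (target I) (tokens I) (budget I) zero inp F B erefl erefl erefl erefl erefl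
  input_problem_graph input_movement_graph input_tokens erefl B_L B_k B_N2
  (@problem_graph_no_negative_cycle I).
have [t1 [m1 [x1 r1 l1]]] := prelude_rep (erefl F).
have F6 : (6 < F)%N by rewrite /F; nia.
have [t2 [m2 [x2 r2 l2]]] := compileP F6 (wf_discovery zero) r1 sd.
have ans : eval m2 (cexp 31 (EV vans)) =
    den inp (discovery zero) (fun _ _ => 0) vans 0%N.
  by rewrite (eval_cexp r2).
exists (t1 + (t2 + 1))%N, (update m2 0 (eval m2 (cexp 31 (EV vans)))); split.
- apply: uexec_seq x1 _; apply: uexec_seq x2 _; exact: uexec_write.
- by rewrite /update eqxx ans.
have := tb_poly B (discovery zero); move: (csize _) => C l3.
have h1 : (B.+1 ^ C <= B.+1 ^ C.+1)%N by rewrite leq_pexp2l.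
have h2 : (B.+1 <= B.+1 ^ C.+1)%N by rewrite -[X in (X <= _)%N]expn1 leq_pexp2l.
have h3 : (C * B.+1 ^ C <= C * B.+1 ^ C.+1)%N by rewrite leq_mul2l h1 orbT.
rewrite mulnDl; lia.
Qed.

End Instance.

Lemma bitsize_encode_gt0 I : (0 < bitsize (encode_instance I))%N.
Proof.
by apply: leq_trans (size_bitsize _); rewrite size_encode_instance.
Qed.

Theorem theorem2 : FPT path_discovery /\ FPT shortest_path_discovery.
Proof.
have yesP zero (I : instance) (spath : seq 'I_(num_vertices I) -> Prop) :
    (forall p, shortest_st_path (searched_graph (problem_graph I) zero) (source I)
       (target I) p <-> spath p) ->
    discoverable (problem_graph I) (movement_graph I) (source I) (target I)
      (tokens I) (budget I) zero <->
    exists T p, [/\ reachable (movement_graph I) (tokens I) (budget I) T,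
                    spath p & {subset p <= T}].
  move=> E; rewrite /discoverable seq_mset_id.
  by split=> -[T [p [rT /E sp pT]]]; exists T, p.
split.
  apply: (@FPT_uexec path_discovery (discovery_program true) _ _ bitsize_encode_gt0) => I.
  have [t [m [ex ans t_le]]] := discovery_programP I true.
  rewrite (yesP _ _ _ (shortest_zero _ _)) in ans.
  by exists t, m; split; [exact: ex | case: ans => -[] | case: ans => -[] | exact: t_le].
apply: (@FPT_uexec shortest_path_discovery (discovery_program false) _ _ bitsize_encode_gt0) => I.
have [t [m [ex ans t_le]]] := discovery_programP I false.
rewrite (yesP _ _ _ (shortest_nonzero _ _)) in ans.
by exists t, m; split; [exact: ex | case: ans => -[] | case: ans => -[] | exact: t_le].
Qed.
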